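(* Let $\alpha\in\omega+1$ and let $\mathbb M$ be a monster model of $T_\alpha$. Let $\bar b$ be a finite tuple and $A,C$ small subsets of $\mathbb M$ with $\mathrm{acl}(A)=A$. Then $\bar b$ is d-independent of $C$ over $A$ if and only if $\bar b$ is independent from $C$ over $A$ in the sense of non-forking.
   Context: Graphs are structures in the language $\mathcal L=\{R\}$ with $R$ a symmetric irreflexive binary relation; substructures are induced subgraphs. For a finite graph $A$ let $\delta(A)=|A|-e(A)$, where $e(A)$ is the number of edges. $\mathcal K_\omega$ is the class of finite graphs $A$ with $\delta(B)>0$ for all nonempty $B\subseteq A$ (the finite forests). For $n\ge1$, $\mathcal K_n$ is the class of members of $\mathcal K_\omega$ satisfying $\forall x\big[\deg(x)\ge n+2\to\neg\exists y_1\dots y_{2n}\big(R(x,y_1)\wedge\bigwedge_{1\le i<j\le 2n}y_i\neq y_j\wedge\bigwedge_{i=2}^{2n}R(y_{i-1},y_i)\big)\big]$, and $\mathcal K_0$ is the class of members of $\mathcal K_\omega$ with all degrees at most $3$; all contain the empty graph. For finite $A\subseteq B$: $A\le^*B$ means $\delta(C)>\delta(A)$ whenever $A\subsetneq C\subseteq B$; $A\le B$ (weakly closed) means $\delta(C)\ge\delta(A)$ whenever $A\subseteq C\subseteq B$. For possibly infinite $M$ and finite $A\subseteq M$, $A\le^*M$ (resp. $A\le M$) means $A\le^*B$ (resp. $A\le B$) for all finite $B$ with $A\subseteq B\subseteq M$. A weak intrinsic extension $A\le_iB$ means $A\subseteq B$ and no $C$ with $A\subseteq C\subsetneq B$ satisfies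 $C\le B$. For $N\subseteq M$, the weak closure $\mathrm{cl}(N)=\mathrm{cl}_M(N)$ is the union of all finite $E\subseteq M$ with $A\le_iE$ for some finite $A\subseteq N$. Dimension in $M$: for finite $X\subseteq M$, $d(X)=\inf\{\delta(Y):X\subseteq Y\subseteq M,\ Y\text{ finite}\}$; for finite $X,Y$, $d(Y/X)=d(X\cup Y)-d(X)$; for arbitrary $N\subseteq M$ and finite $X$, $d(X/N)=\inf\{d(X/B):B\subseteq N\text{ finite}\}$. A finite tuple $\bar b$ is d-independent of $C$ over $A$ if (a) $d(\bar b/A)=d(\bar b/A\cup C)$ and (b) $\mathrm{cl}(\bar bA)\cap\mathrm{cl}(A\cup C)=\mathrm{cl}(A)$. A closed embedding $f:B\to M$ is an isomorphism onto an induced subgraph $f(B)$ with $f(B)\le^*M$. $\mathfrak M_\alpha$ is the unique countable graph whose finite induced subgraphs lie in $\mathcal K_\alpha$ and which satisfies: every $A\in\mathcal K_\alpha$ has a closed embedding into it; whenever $A\le^*B\in\mathcal K_\alpha$ and $A\le^*\mathfrak M_\alpha$ there is a closed embedding of $B$ into $\mathfrak M_\alpha$ fixing $A$ pointwise; and it is the union of a chain $A_0\le^*A_1\le^*\cdots$ of members of $\mathcal K_\alpha$. $T_\alpha=\mathrm{Th}(\mathfrak M_\alpha)$, which is stable. *)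

(* Defs.v *)
From HB Require Import structures.
From mathcomp Require Import all_boot all_order all_algebra.
From mathcomp Require Import finmap.
From mathcomp Require Import boolp classical_sets functions cardinality.

Set Implicit Arguments.
Unset Strict Implicit.
Unset Printing Implicit Defensive.

Import Order.TTheory GRing.Theory Num.Theory.

Local Open Scope fset_scope.
Local Open Scope classical_set_scope.
Local Open Scope card_scope.

Record graph := Graph {
  vertex :> choiceType;
  adj : rel vertex;
  adj_sym : symmetric adj;
  adj_irr : irreflexive adj }.

Arguments adj {g}.

(* Finite graphs are handled as finite sets of vertices of a graph, with the
   induced subgraph structure. *)
Section FiniteSubgraphs.
Variable M : graph.
Implicit Types A B C E : {fset M}.

Definition edges A : {fset {fset M}} :=
  [fset [fset x; y] | x in A, y in A & adj x y]%fset.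

Definition delta A : int := (#|` A|%:Z - #|` edges A|%:Z)%R.

Definition deg A (x : M) : nat := #|` [fset y in A | adj x y]%fset|.

(* A <=* B *)
Definition strong A B : Prop :=
  (A `<=` B)%fset /\
  forall C, (A `<` C)%fset -> (C `<=` B)%fset -> (delta A < delta C)%R.

(* A <= B *)
Definition weakly_closed A B : Prop :=
  (A `<=` B)%fset /\
  forall C, (A `<=` C)%fset -> (C `<=` B)%fset -> (delta A <= delta C)%R.

(* A <=* M *)
Definition strong_in A : Prop := forall B, (A `<=` B)%fset -> strong A B.

(* A <=_i E *)
Definition weak_intrinsic A E : Prop :=
  (A `<=` E)%fset /\
  forall C, (A `<=` C)%fset -> (C `<` E)%fset -> ~ weakly_closed C E.

Definition cl (N : set M) : set M :=
  [set x | exists A E, [/\ [set` A] `<=` N, weak_intrinsic A E & x \in E]].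

(* [infimum 0] is the greatest lower bound in int whenever there is one; when
   every finite set of vertices is a forest, the sets below are nonempty and
   bounded below by 0. *)
Definition ddim (X : {fset M}) : int :=
  infimum 0%R [set delta Y | Y in [set Y | (X `<=` Y)%fset]].

Definition ddim_rel (Y X : {fset M}) : int := (ddim (X `|` Y)%fset - ddim X)%R.

Definition ddim_over (X : {fset M}) (N : set M) : int :=
  infimum 0%R [set ddim_rel X B | B in [set B : {fset M} | [set` B] `<=` N]].

Definition d_independent n (b : n.-tuple M) (C A : set M) : Prop :=
  ddim_over [fset x in tval b]%fset A = ddim_over [fset x in tval b]%fset (A `|` C) /\
  cl ([set` b] `|` A) `&` cl (A `|` C) = cl A.

End FiniteSubgraphs.

Inductive omega_plus_one := Fin of nat | Omega.

(* The induced subgraph on A belongs to K_alpha.  In the path condition only the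
   y's are pairwise distinct: one of them may be equal to x. *)
Definition in_K (alpha : omega_plus_one) (M : graph) (A : {fset M}) : Prop :=
  (forall B : {fset M}, (B `<=` A)%fset -> B != fset0 -> (0 < delta B)%R) /\
  match alpha with
  | Omega => True
  | Fin 0 => forall x, x \in A -> deg A x <= 3
  | Fin n => forall x, x \in A -> n + 2 <= deg A x ->
      ~ exists y : (2 * n).-tuple M,
          [/\ {subset y <= A}, uniq y & path adj x y]
  end.

(* f restricted to B is a closed embedding of B into M; the values of f outside
   B are irrelevant. *)
Definition closed_embedding (G M : graph) (B : {fset G}) (f : G -> M) : Prop :=
  [/\ {in B &, injective f},
      {in B &, {mono f : x y / adj x y}} &
      strong_in (f @` B)%fset].

Definition generic (alpha : omega_plus_one) (M : graph) : Prop :=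
  [/\ countable [set: M],
      forall A : {fset M}, in_K alpha A,
      forall (G : graph) (A : {fset G}), in_K alpha A ->
        exists f : G -> M, closed_embedding A f,
      forall (G : graph) (A B : {fset G}) (f : G -> M),
        in_K alpha B -> strong A B -> closed_embedding A f ->
        exists g : G -> M, closed_embedding B g /\ {in A, g =1 f} &
      exists A : nat -> {fset M},
        [/\ forall i, in_K alpha (A i),
            forall i, strong (A i) (A i.+1) &
            forall x, exists i, x \in A i]].

(* First-order formulas in the language {R}, with n free variables.  [FAll]
   binds variable 0 and shifts the others. *)
Inductive formula : nat -> Type :=
| FFalse n : formula n
| FEq n : 'I_n -> 'I_n -> formula n
| FAdj n : 'I_n -> 'I_n -> formula n
| FImp n : formula n -> formula n -> formula n
| FAll n : formula n.+1 -> formula n.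

Fixpoint sat (M : graph) n (phi : formula n) : n.-tuple M -> Prop :=
  match phi in formula n return n.-tuple M -> Prop with
  | FFalse _ => fun=> False
  | FEq _ i j => fun v => tnth v i = tnth v j
  | FAdj _ i j => fun v => adj (tnth v i) (tnth v j)
  | FImp _ f g => fun v => sat f v -> sat g v
  | FAll _ f => fun v => forall a : M, sat f [tuple of a :: v]
  end.

Definition Th (M : graph) : set (formula 0) :=
  [set phi | sat phi ([tuple] : 0.-tuple M)].

Definition models (M : graph) (T : set (formula 0)) : Prop := T `<=` Th M.

(* Formulas in n variables with parameters from M; the parameters instantiate
   the last npar variables of [pform]. *)
Record pformula (M : graph) (n : nat) := PFormula {
  npar : nat;
  pform : formula (n + npar);
  par : npar.-tuple M }.

Section ModelTheory.
Variable M : graph.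

Definition holds n (phi : pformula M n) (x : n.-tuple M) : Prop :=
  sat (pform phi) [tuple of x ++ par phi].

Definition params_in n (A : set M) : set (pformula M n) :=
  [set phi | [set` par phi] `<=` A].

Definition tp n (x : n.-tuple M) (A : set M) : set (pformula M n) :=
  [set phi | params_in A phi /\ holds phi x].

Definition acl (A : set M) : set M :=
  [set x | exists phi : pformula M 1,
     [/\ params_in A phi, holds phi [tuple x] &
         finite_set [set y | holds phi [tuple y]]]].

Definition small (kappa : Type) (A : set M) : Prop :=
  A #<= [set: kappa] /\ ~ ([set: kappa] #<= A).

Definition saturated (kappa : Type) : Prop :=
  forall (A : set M) (p : set (pformula M 1)),
    small kappa A -> p `<=` params_in A ->
    (forall F, finite_set F -> F `<=` p ->
       exists x, forall phi, F phi -> holds phi [tuple x]) ->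
    exists x, forall phi, p phi -> holds phi [tuple x].

Definition elementary_on (S : set M) (f : M -> M) : Prop :=
  forall n (phi : formula n) (v : n.-tuple M), [set` v] `<=` S ->
    (sat phi v <-> sat phi [tuple of map f v]).

Definition automorphism (s : M -> M) : Prop :=
  bijective s /\ {mono s : x y / adj x y}.

Definition strongly_homogeneous (kappa : Type) : Prop :=
  forall (S : set M) (f : M -> M), small kappa S -> elementary_on S f ->
    exists s, automorphism s /\ forall x, S x -> s x = f x.

Definition divides n (A : set M) (phi : pformula M n) : Prop :=
  exists (k : nat) (c : nat -> (npar phi).-tuple M),
    (forall i, tp (c i) A = tp (par phi) A) /\
    forall I : {fset nat}, #|` I| = k ->
      ~ exists x, forall i, i \in I -> holds (PFormula (pform phi) (c i)) x.

Definition forks n (A : set M) (phi : pformula M n) : Prop :=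
  exists D : set (pformula M n),
    [/\ finite_set D, D `<=` divides A &
        forall x, holds phi x -> exists2 psi, D psi & holds psi x].

(* tp(b / A u C) does not fork over A *)
Definition nonforking_independent n (b : n.-tuple M) (C A : set M) : Prop :=
  forall phi, tp b (A `|` C) phi -> ~ forks A phi.

End ModelTheory.

(* kappa stands for the cardinal |kappa|, which exceeds |T| = aleph_0. *)
Definition monster (kappa : Type) (T : set (formula 0)) (M : graph) : Prop :=
  [/\ ~ countable [set: kappa], models M T,
      saturated M kappa & strongly_homogeneous M kappa].

(* Main.v *)
Require Import Defs.
From HB Require Import structures.
From mathcomp Require Import all_boot all_order all_algebra.
From mathcomp Require Import finmap.
From mathcomp Require Import boolp classical_sets functions cardinality.
From mathcomp Require Import zify.

Set Implicit Arguments.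
Unset Strict Implicit.
Unset Printing Implicit Defensive.

Import Order.TTheory GRing.Theory Num.Theory.

Local Open Scope fset_scope.
Local Open Scope classical_set_scope.
Local Open Scope card_scope.

(* Every finite set of vertices of M is a forest, so delta counts components, d(X)
   is the number of components of M that meet X, and cl(N) is the union of the
   paths between points of N.  Hence, for algebraically closed (in particular
   convex) A, d-independence of b from C over A says that A separates b from C:
   every path from a point of b to a point of C meets A.

   If a vertex is not in A, then its component in the complement of A has at most
   one neighbour in A, and it can be moved by an automorphism fixing A pointwise
   into a component that avoids any given finite set.  This gives a formula that
   divides over A when separation fails.  Conversely, an automorphism that fixes
   A pointwise and moves a union U of components of the complement of A off
   itself can be replaced by the one that exchanges U with its image and fixes
   everything else.  So a copy of b separated by A from everything in sight
   realizes a given formula of tp(b/AC), and it realizes simultaneously the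
   conjugates over A of any formula whose parameters it is separated from: none
   of these formulas divides. *)

(** * Predimension and walks in forests *)

Section Delta.
Variable M : graph.
Implicit Types (X Y Z : {fset M}) (x y z : M).

Lemma edgesP X (e : {fset M}) :
  reflect (exists x y, [/\ x \in X, y \in X, adj x y & e = [fset x; y]%fset])
          (e \in edges X).
Proof.
apply: (iffP idP).
  case/imfset2P => x /= xX [y]; rewrite inE => /andP[/= yX xy] ->.
  by exists x, y.
case=> x [y [xX yX xy ->]]; apply/imfset2P; exists x => //.
by exists y => //; rewrite inE /= yX.
Qed.

Lemma edges0 : edges (fset0 : {fset M}) = fset0.
Proof. by apply/fsetP => e; apply/edgesP; rewrite inE => -[x [y []]]. Qed.

Lemma delta0 : delta (fset0 : {fset M}) = 0%R.
Proof. by rewrite /delta edges0 !cardfs0. Qed.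

Lemma edges_add1 X v : v \notin X ->
  #|` edges (v |` X)%fset| = (#|` edges X| + deg X v)%N.
Proof.
move=> vX.
pose N := [fset [fset v; y] | y in [fset y in X | adj v y]]%fset.
have -> : edges (v |` X)%fset = (edges X `|` N)%fset.
  apply/fsetP => e; rewrite inE; apply/edgesP/orP.
    case=> x [y [+ + xy ->]].
    rewrite !inE => /predU1P[xv|xX] /predU1P[yv|yX].
    - by move: xy; rewrite xv yv adj_irr.
    - by right; apply/imfsetP; exists y; rewrite ?inE /= ?yX -?xv.
    - right; apply/imfsetP; exists x; rewrite ?inE /= ?xX -?yv ?[adj y x]adj_sym //.
      by rewrite fsetUC.
    - by left; apply/edgesP; exists x, y.
  case.
    by case/edgesP => x [y [xX yX xy ->]]; exists x, y; split=> //; rewrite !inE ?xX ?yX orbT.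
  case/imfsetP => y /=; rewrite !inE /= => /andP[yX vy] ->.
  by exists v, y; rewrite !inE eqxx yX orbT.
rewrite cardfsU; have -> : (edges X `&` N = fset0)%fset.
  apply/fsetP => e; rewrite !inE; apply/negbTE/negP => /andP[/edgesP[x [y [xX yX _ ->]]]].
  case/imfsetP => z _ /fsetP /(_ v); rewrite !inE eqxx /= => /orP[] /eqP vE.
    by rewrite vE xX in vX.
  by rewrite vE yX in vX.
rewrite cardfs0 subn0 card_in_imfset //= => y z.
rewrite !inE /= => /andP[yX vy] /andP[zX vz] /fsetP /(_ y).
rewrite !inE eqxx orbT => /esym/orP[] /eqP // yv.
by rewrite yv adj_irr in vy.
Qed.

Lemma delta_add1 X v : v \notin X ->
  delta (v |` X)%fset = (delta X + 1 - (deg X v)%:Z)%R.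
Proof.
move=> vX; rewrite /delta edges_add1 // cardfsU1 vX; lia.
Qed.

Lemma deg_count (s : seq M) v : uniq s -> deg [fset x in s]%fset v = count (adj v) s.
Proof.
move=> us; rewrite /deg -size_filter.
have -> : [fset y in [fset x in s] | adj v y]%fset = [fset y in filter (adj v) s]%fset.
  by apply/fsetP => y; rewrite !inE mem_filter andbC.
by rewrite -(@undup_id _ (filter _ s)) ?filter_uniq // card_fseq !undup_id ?filter_uniq.
Qed.

Lemma deg_gt0 X v w : w \in X -> adj v w -> (0 < deg X v)%N.
Proof.
move=> wX vw; rewrite /deg cardfs_gt0; apply/fset0Pn; exists w.
by rewrite !inE /= wX.
Qed.

Lemma deg_gt1 X v w w' : w \in X -> w' \in X -> adj v w -> adj v w' -> w != w' ->
  (1 < deg X v)%N.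
Proof.
move=> wX w'X vw vw' ww'; rewrite /deg (cardfsD1 w) !inE /= wX vw /= add1n ltnS cardfs_gt0.
by apply/fset0Pn; exists w'; rewrite !inE /= w'X vw' eq_sym ww'.
Qed.

Lemma delta_add_neighbor X v w : w \in X -> adj v w -> (delta (v |` X)%fset <= delta X)%R.
Proof.
move=> wX vw; case: (boolP (v \in X)) => [vX|vX].
  by rewrite (fsetUidPr _ _ _) // fsub1set.
rewrite delta_add1 //; have := deg_gt0 wX vw; lia.
Qed.

Lemma delta_add_le X v : (delta (v |` X)%fset <= delta X + 1)%R.
Proof.
case: (boolP (v \in X)) => [vX|vX].
  rewrite (fsetUidPr _ _ _) ?fsub1set //; lia.
rewrite delta_add1 //; lia.
Qed.

Lemma delta_path x (p : seq M) : path adj x p -> uniq (x :: p) ->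
  (delta [fset y in x :: p]%fset <= 1)%R.
Proof.
elim: p x => [|y p IH] x /=.
  move=> _ _; have -> : [fset y in [:: x]]%fset = (x |` fset0)%fset.
    by apply/fsetP => y; rewrite !inE orbF.
  by have := delta_add_le fset0 x; rewrite delta0.
case/andP=> xy pth /andP[xp up].
have -> : [fset z in [:: x, y & p]]%fset = (x |` [fset z in y :: p])%fset.
  by apply/fsetP => z; rewrite !inE.
apply: le_trans (IH y pth up); apply: (@delta_add_neighbor _ _ y) => //.
by rewrite !inE eqxx.
Qed.

Lemma edges_union_le X Y (Q : {fset {fset M}}) :
  (forall x y, x \in X -> y \in Y -> adj x y -> [fset x; y]%fset \in Q) ->
  (#|` edges (X `|` Y)%fset| <= #|` edges X| + #|` edges Y| + #|` Q|)%N.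
Proof.
move=> HQ.
have sub : (edges (X `|` Y) `<=` edges X `|` edges Y `|` Q)%fset.
  apply/fsubsetP => e /edgesP[x [y [+ + xy ->]]]; rewrite !inE.
  case/orP=> hx /orP[] hy.
  - by apply/orP; left; apply/orP; left; apply/edgesP; exists x, y.
  - by rewrite HQ ?orbT.
  - by rewrite fsetUC HQ ?orbT // adj_sym.
  - by apply/orP; left; apply/orP; right; apply/edgesP; exists x, y.
apply: leq_trans (fsubset_leq_card sub) _.
by rewrite !cardfsU; lia.
Qed.

(** [Q] only bounds the cross edges from above; it will be empty or a single edge. *)
Lemma delta_disjoint_union X Y (Q : {fset {fset M}}) : [disjoint X & Y]%fset ->
  (forall x y, x \in X -> y \in Y -> adj x y -> [fset x; y]%fset \in Q) ->
  (delta X + delta Y - #|` Q|%:Z <= delta (X `|` Y)%fset)%R.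
Proof.
move=> /eqP dXY /edges_union_le; rewrite /delta cardfsU dXY cardfs0; lia.
Qed.

(** * Forests and walks avoiding a set *)

Definition forest := forall X, X != fset0 -> (0 < delta X)%R.

(** [F] is the set of forbidden vertices, endpoints included. Fixing the length keeps the relation
    first-order definable whenever [F] is; [conn] loses this. *)
Fixpoint walk (F : set M) (l : nat) (x y : M) : Prop :=
  match l with
  | 0 => x = y /\ ~ F x
  | l'.+1 => ~ F x /\ exists z, adj x z /\ walk F l' z y
  end.

Definition conn F x y := exists l, walk F l x y.

Lemma walk_trans F l k x y z : walk F l x y -> walk F k y z -> walk F (l + k) x z.
Proof.
elim: l x => [|l IH] x /=; first by case=> ->.
case=> Fx [w [xw wy]] yz; split=> //; exists w; split=> //; exact: IH.
Qed.

Lemma walk_start F l x y : walk F l x y -> ~ F x.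
Proof. by case: l => [|l] /= []. Qed.

Lemma walk_end F l x y : walk F l x y -> ~ F y.
Proof. by elim: l x => [|l IH] x /= [] => [->//|_ [z [_ /IH]]]. Qed.

Lemma walk1 F x y : ~ F x -> ~ F y -> adj x y -> walk F 1 x y.
Proof. by move=> Fx Fy xy; split=> //; exists y; split. Qed.

Lemma walk_sym F l x y : walk F l x y -> walk F l y x.
Proof.
elim: l x => [|l IH] x /=; first by case=> -> ?.
case=> Fx [z [xz zy]]; have zx : walk F 1 z x.
  by apply: walk1 => //; [exact: walk_start zy | rewrite adj_sym].
by have := walk_trans (IH _ zy) zx; rewrite addn1.
Qed.

Lemma walk_sub F F' l x y : F' `<=` F -> walk F l x y -> walk F' l x y.
Proof.
move=> sF; elim: l x => [|l IH] x /= [h1 h2]; split=> //; try by move/sF.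
by case: h2 => z [xz /IH]; exists z.
Qed.

Lemma conn_refl F x : ~ F x -> conn F x x.
Proof. by exists 0. Qed.

Lemma conn_trans F x y z : conn F x y -> conn F y z -> conn F x z.
Proof. by move=> [l xy] [k yz]; exists (l + k)%N; apply: walk_trans yz. Qed.

Lemma conn_sym F x y : conn F x y -> conn F y x.
Proof. by move=> [l /walk_sym]; exists l. Qed.

Lemma conn_start F x y : conn F x y -> ~ F x.
Proof. by case=> l /walk_start. Qed.

Lemma conn_end F x y : conn F x y -> ~ F y.
Proof. by case=> l /walk_end. Qed.

Lemma conn_sub F F' x y : F' `<=` F -> conn F x y -> conn F' x y.
Proof. by move=> sF [l /(walk_sub sF)]; exists l. Qed.

Lemma conn1 F x y : ~ F x -> ~ F y -> adj x y -> conn F x y.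
Proof. by move=> Fx Fy xy; exists 1; apply: walk1. Qed.

Lemma conn0_sub F x y : conn F x y -> conn set0 x y.
Proof. exact: conn_sub. Qed.

Lemma walkP F l x y : walk F l x y <->
  exists p, [/\ path adj x p, last x p = y, size p = l & forall z, z \in x :: p -> ~ F z].
Proof.
split.
  elim: l x => [|l IH] x /=.
    by case=> <- Fx; exists [::]; split=> // z; rewrite inE => /eqP ->.
  case=> Fx [z [xz /IH[p [pp lp sp Fp]]]]; exists (z :: p); split=> //=.
  - by rewrite xz.
  - by rewrite sp.
  - by move=> w; rewrite inE => /predU1P[->|/Fp].
elim: l x => [|l IH] x [p [pp lp sp Fp]].
  by case: p pp lp sp Fp => //= _ -> _ Fp; split=> //; apply: Fp; rewrite inE.
case: p pp lp sp Fp => //= z p /andP[xz pp] lp [sp] Fp; split.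
  by apply: Fp; rewrite inE eqxx.
exists z; split=> //; apply: IH; exists p; split=> // w wp.
by apply: Fp; rewrite inE wp orbT.
Qed.

Lemma conn_upath F x y : conn F x y ->
  exists p, [/\ path adj x p, last x p = y, uniq (x :: p) & forall z, z \in x :: p -> ~ F z].
Proof.
case=> l /walkP[p [pp lp _ Fp]].
case/shortenP: pp lp => p' pp' up' sp' lp'; exists p'; split=> // z.
rewrite inE => /predU1P[->|zp]; apply: Fp; rewrite inE ?eqxx //.
by rewrite (sp' _ zp) orbT.
Qed.

Lemma path_conn F x p y : path adj x p -> (forall z, z \in x :: p -> ~ F z) ->
  y \in x :: p -> conn F x y.
Proof.
move=> + + yp; case/splitPl: yp => p1 p2 lp1; rewrite cat_path => /andP[pp _] Fp.
exists (size p1); apply/walkP; exists p1; split=> // z zp; apply: Fp.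
by move: zp; rewrite !inE mem_cat => /orP[->|->] //; rewrite orbT.
Qed.

(* Two neighbours of [a] joined by a path avoiding [a] would close a cycle. *)
Lemma branch_unique a v w : forest -> adj a v -> adj a w -> conn [set a] v w -> v = w.
Proof.
move=> hF av aw /conn_upath[p [pp lp up Fp]]; apply: contrapT => /eqP vw.
have wp : w \in v :: p by rewrite -lp mem_last.
have vp : v \in v :: p by rewrite inE eqxx.
have ap : a \notin v :: p by apply/negP => /Fp; apply.
(* The path has delta at most 1 and [a] has two neighbours on it, so adding [a] brings delta down to
   at most 0. *)
have := hF (a |` [fset y in v :: p])%fset; rewrite delta_add1; last by move: ap; rewrite !inE.
have vX : v \in [fset y in v :: p]%fset by rewrite !inE eqxx.
have wX : w \in [fset y in v :: p]%fset by move: wp; rewrite !inE.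
have := deg_gt1 vX wX av aw vw; have := delta_path pp up.
have -> : (a |` [fset y in v :: p])%fset != fset0.
  by apply/fset0Pn; exists a; rewrite !inE eqxx.
by move=> h1 h2 /(_ isT); lia.
Qed.

Lemma forest_triangle x y z : forest -> adj x y -> adj x z -> adj y z -> False.
Proof.
move=> hF xy xz yz.
have : y = z.
  apply: (branch_unique hF xy xz); apply: conn1 => //= e;
   [by move: xy; rewrite e adj_irr | by move: xz; rewrite e adj_irr].
by move=> e; rewrite e adj_irr in yz.
Qed.

End Delta.

(** * Definable relations and automorphisms *)

Definition up_ren n m (g : 'I_n -> 'I_m) (i : 'I_n.+1) : 'I_m.+1 :=
  if unlift ord0 i is Some j then lift ord0 (g j) else ord0.

Fixpoint rename n (phi : formula n) : forall m, ('I_n -> 'I_m) -> formula m :=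
  match phi in formula n return forall m, ('I_n -> 'I_m) -> formula m with
  | FFalse _ => fun m g => FFalse m
  | FEq _ i j => fun m g => FEq (g i) (g j)
  | FAdj _ i j => fun m g => FAdj (g i) (g j)
  | FImp _ f1 f2 => fun m g => FImp (rename f1 g) (rename f2 g)
  | FAll _ f => fun m g => FAll (rename f (up_ren g))
  end.

Lemma sat_rename (M : graph) n (phi : formula n) m (g : 'I_n -> 'I_m)
    (v : m.-tuple M) (w : n.-tuple M) :
  (forall i, tnth w i = tnth v (g i)) -> sat (rename phi g) v <-> sat phi w.
Proof.
elim: phi m g v w => {n} [n|n i j|n i j|n f1 IH1 f2 IH2|n f IH] m g v w H /=.
- by [].
- by rewrite !H.
- by rewrite !H.
- by have [h1 h1'] := IH1 _ _ _ _ H; have [h2 h2'] := IH2 _ _ _ _ H; split; tauto.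
- have K a : sat (rename f (up_ren g)) [tuple of a :: v] <-> sat f [tuple of a :: w].
    apply: IH => i; rewrite /up_ren; case: unliftP => [j ->|->].
      by rewrite !tnthS H.
    by rewrite !tnth0.
  by split=> h a; apply/K.
Qed.

Lemma sat_automorphism (M : graph) n (phi : formula n) (s : M -> M) (v w : n.-tuple M) :
  automorphism s -> (forall i, tnth w i = s (tnth v i)) -> sat phi w <-> sat phi v.
Proof.
case=> bs ms; have injs := bij_inj bs.
elim: phi v w => {n} [n|n i j|n i j|n f1 IH1 f2 IH2|n f IH] v w H /=.
- by [].
- by rewrite !H; split=> [/injs|->].
- by rewrite !H ms.
- by have [h1 h1'] := IH1 _ _ H; have [h2 h2'] := IH2 _ _ H; split; tauto.
- have K a : sat f [tuple of s a :: w] <-> sat f [tuple of a :: v].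
    apply: IH => i; case: (unliftP ord0 i) => [j ->|->]; first by rewrite !tnthS H.
    by rewrite !tnth0.
  case: bs => s' sK s'K; split=> h a; first exact/K.
  by rewrite -(s'K a); apply/K.
Qed.

Section Definability.
Variable M : graph.
Implicit Types (A : set M) (P Q : (nat -> M) -> Prop) (e : nat -> M).

Definition teval e (t : nat + M) : M := match t with inl k => e k | inr a => a end.

Definition tparam (A : set M) (t : nat + M) : Prop :=
  match t with inl _ => True | inr a => A a end.

(* [P] is a relation on valuations of the variables 0, 1, 2, ... that is given
   by a formula with parameters in [A]. *)
Definition dfn A P := exists n (phi : formula n) (t : 'I_n -> nat + M),
  (forall i, tparam A (t i)) /\ forall e, P e <-> sat phi [tuple teval e (t i) | i < n].

Definition trm A (f : (nat -> M) -> M) := exists t, tparam A t /\ forall e, f e = teval e t.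

Definition scons (a : M) e : nat -> M := fun i => if i is i'.+1 then e i' else a.

Lemma trm_var A k : trm A (fun e => e k).
Proof. by exists (inl k). Qed.

Lemma trm_par A a : A a -> trm A (fun e => a).
Proof. by exists (inr a). Qed.

Lemma trm_shift A f : trm A f -> trm A (fun e => f (fun i => e i.+1)).
Proof.
case=> [[k|a] [hA h]]; first by exists (inl k.+1); split=> // e; rewrite h.
by exists (inr a); split=> // e; rewrite h.
Qed.

Lemma dfn_ext A P Q : (forall e, P e <-> Q e) -> dfn A P -> dfn A Q.
Proof.
move=> PQ [n [phi [t [tA h]]]]; exists n, phi, t; split=> // e.
by rewrite -h; split=> /PQ.
Qed.

Lemma dfn_sub A A' P : A `<=` A' -> dfn A P -> dfn A' P.
Proof.
move=> sA [n [phi [t [tA h]]]]; exists n, phi, t; split=> // i.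
by move: (tA i); case: (t i) => //= a /sA.
Qed.

Lemma dfn_false A : dfn A (fun=> False).
Proof.
exists 0, (FFalse 0), (fun _ => inl 0%N); split=> //.
Qed.

Lemma dfn_true A : dfn A (fun=> True).
Proof.
exists 0, (FImp (FFalse 0) (FFalse 0)), (fun _ => inl 0%N); split=> // e /=.
by split.
Qed.

Definition pair_fun T (x y : T) (i : 'I_2) := if i == ord0 then x else y.

Lemma dfn_eq A f g : trm A f -> trm A g -> dfn A (fun e => f e = g e).
Proof.
move=> [t [tA tE]] [u [uA uE]].
exists 2, (FEq ord0 (lift ord0 ord0)), (pair_fun t u); split.
  by move=> i; rewrite /pair_fun; case: ifP.
by move=> e /=; rewrite !tnth_mktuple tE uE.
Qed.

Lemma dfn_adj A f g : trm A f -> trm A g -> dfn A (fun e => adj (f e) (g e)).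
Proof.
move=> [t [tA tE]] [u [uA uE]].
exists 2, (FAdj ord0 (lift ord0 ord0)), (pair_fun t u); split.
  by move=> i; rewrite /pair_fun; case: ifP.
by move=> e /=; rewrite !tnth_mktuple tE uE.
Qed.

Lemma dfn_imp A P Q : dfn A P -> dfn A Q -> dfn A (fun e => P e -> Q e).
Proof.
move=> [n [f [t [tA hP]]]] [m [g [u [uA hQ]]]].
pose tu (i : 'I_(n + m)) := match fintype.split i with inl j => t j | inr j => u j end.
exists (n + m)%N, (FImp (rename f (lshift m)) (rename g (@rshift n m))), tu; split.
  by move=> i; rewrite /tu; case: fintype.split.
move=> e /=; set v := mktuple _.
have -> : sat (rename f (lshift m)) v = P e.
  apply/propext; rewrite hP; apply: sat_rename => i.
  by rewrite !tnth_mktuple /tu (unsplitK (inl i)).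
have -> // : sat (rename g (@rshift n m)) v = Q e.
apply/propext; rewrite hQ; apply: sat_rename => i.
by rewrite !tnth_mktuple /tu (unsplitK (inr i)).
Qed.

Lemma dfn_all_scons A P : dfn A P -> dfn A (fun e => forall a, P (scons a e)).
Proof.
move=> [n [f [t [tA hP]]]].
(* Places holding variable 0 become the bound variable; the other variables shift down by one, and
   the value [k.-1] at [k = 0] is never read. *)
pose g (i : 'I_n) : 'I_n.+1 := if t i is inl 0 then ord0 else lift ord0 i.
pose u (i : 'I_n) : nat + M := match t i with inl k => inl k.-1 | inr a => inr a end.
exists n, (FAll (rename f g)), u; split.
  by move=> i; rewrite /u; have := tA i; case: (t i).
move=> e /=; have K a : sat (rename f g) [tuple of a :: [tuple teval e (u i) | i < n]]
    <-> P (scons a e).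
  rewrite hP; apply: sat_rename => i; rewrite tnth_mktuple /g.
  case ti: (t i) => [[|k]|b] /=; rewrite ?tnth0 // tnthS tnth_mktuple /u ti //.
by split=> h a; apply/K.
Qed.

(** Stated for [Q a e] because [scons a e] computes: its value at 0 is [a] and its shift is [e], so
    the quantified relation can be written directly. *)
Lemma dfn_all A (Q : M -> (nat -> M) -> Prop) :
  dfn A (fun e => Q (e 0) (fun i => e i.+1)) -> dfn A (fun e => forall a, Q a e).
Proof. exact: dfn_all_scons. Qed.

Lemma dfn_not A P : dfn A P -> dfn A (fun e => ~ P e).
Proof. by move=> h; apply: dfn_imp h (dfn_false A). Qed.

Lemma dfn_and A P Q : dfn A P -> dfn A Q -> dfn A (fun e => P e /\ Q e).
Proof.
move=> hP hQ; apply: dfn_ext (dfn_not (dfn_imp hP (dfn_not hQ))) => e /=.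
split; last by case=> p q; apply.
by move=> h; split; apply: contrapT => h'; apply: h => // p q; exact: h'.
Qed.

Lemma dfn_or A P Q : dfn A P -> dfn A Q -> dfn A (fun e => P e \/ Q e).
Proof.
move=> hP hQ; apply: dfn_ext (dfn_imp (dfn_not hP) hQ) => e /=.
split; last by case=> // p np.
by move=> h; case: (EM (P e)) => [|/h]; [left|right].
Qed.

Lemma dfn_ex A (Q : M -> (nat -> M) -> Prop) :
  dfn A (fun e => Q (e 0) (fun i => e i.+1)) -> dfn A (fun e => exists a, Q a e).
Proof.
move=> h; apply: (@dfn_ext _ (fun e => ~ forall a, ~ Q a e)).
  move=> e; split; last by case=> a Qa /(_ a).
  by move=> h'; apply: contrapT => /forallNP.
by apply/dfn_not/(@dfn_all _ (fun a e => ~ Q a e))/dfn_not.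
Qed.

Lemma dfn_walk A (F : set M) l f g :
  (forall f, trm A f -> dfn A (fun e => ~ F (f e))) -> trm A f -> trm A g ->
  dfn A (fun e => walk F l (f e) (g e)).
Proof.
move=> dF; elim: l f g => [|l IH] f g tf tg /=.
  by apply: dfn_and (dF _ tf); apply: dfn_eq.
apply: dfn_and (dF _ tf) _.
apply: (@dfn_ex _ (fun z e => adj (f e) z /\ walk F l z (g e))).
apply: dfn_and; first by apply: dfn_adj; [exact: trm_shift | exact: trm_var].
by apply: (IH _ (fun e => g (fun i => e i.+1))); [exact: trm_var | exact: trm_shift].
Qed.

Lemma dfn_holds A n (phi : pformula M n) (k : 'I_n -> nat) : params_in A phi ->
  dfn A (fun e => holds phi [tuple e (k i) | i < n]).
Proof.
move=> pA.
pose t (i : 'I_(n + npar phi)) : nat + M :=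
  match fintype.split i with inl j => inl (k j) | inr j => inr (tnth (par phi) j) end.
exists (n + npar phi)%N, (pform phi), t; split.
  move=> i; rewrite /t; case: fintype.split => //= j; apply: pA; exact: mem_tnth.
move=> e; rewrite /holds.
set v := (X in sat _ X <-> _); set w := (X in _ <-> sat _ X).
have -> // : v = w.
apply: eq_from_tnth => i; rewrite tnth_mktuple -(splitK i) /t unsplitK.
by case: (fintype.split i) => j /=; rewrite ?tnth_lshift ?tnth_rshift ?tnth_mktuple.
Qed.

(** Valuations give values to all natural numbers, so variables from [n] on are read as coordinate
    [i0]. *)
Definition env n (i0 : 'I_n) (x : n.-tuple M) : nat -> M := fun i => nth (tnth x i0) x i.

Lemma dfn_pformula A P n (i0 : 'I_n) : dfn A P ->
  exists phi : pformula M n, params_in A phi /\ forall x, holds phi x <-> P (env i0 x).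
Proof.
move=> [m [f [t [tA hP]]]].
pose ps := [seq a | x <- enum 'I_m, a <- if t x is inr a then [:: a] else [::]].
have mps i a : t i = inr a -> a \in ps.
  move=> ti; apply/allpairsPdep; by exists i, a; split; rewrite ?mem_enum ?ti ?inE.
pose vr (k : nat) : 'I_n := odflt i0 (insub k).
(* Variables from [n] on go to [i0], matching [env]; the default for parameters is never taken,
   since every parameter occurs in [ps]. *)
pose g (i : 'I_m) : 'I_(n + size ps) :=
  match t i with
  | inl k => lshift _ (vr k)
  | inr a => odflt (lshift _ i0) (omap (@rshift n (size ps)) (insub (index a ps)))
  end.
exists (@PFormula M n (size ps) (rename f g) (in_tuple ps)); split.
  move=> a /= /allpairsPdep[i [b [_ bi ->]]]; have := tA i.
  by move: bi; case: (t i) => //= c; rewrite inE => /eqP ->.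
move=> x; rewrite hP /holds /=; apply: sat_rename => i.
rewrite tnth_mktuple /g; case ti: (t i) => [k|a] /=.
  rewrite tnth_lshift /vr /env; case: insubP => [j _ <-|] /=.
    by rewrite -tnth_nth.
  by rewrite -leqNgt => kn; rewrite nth_default // size_tuple.
have ia : index a ps < size ps by rewrite index_mem; exact: mps ti.
rewrite insubT /= tnth_rshift (tnth_nth a) /= nth_index //; exact: mps ti.
Qed.

End Definability.

(** * Automorphisms, homogeneity and saturation *)

Lemma automorphism_inv (M : graph) (s : M -> M) : automorphism s ->
  exists s', [/\ automorphism s', cancel s s' & cancel s' s].
Proof.
case=> [[s' sK s'K] ms]; exists s'; split=> //; split; first by exists s.
by move=> x y; rewrite -{2}(s'K x) -{2}(s'K y) ms.
Qed.

Lemma automorphism_comp (M : graph) (s t : M -> M) : automorphism s -> automorphism t ->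
  automorphism (s \o t).
Proof.
move=> [bs ms] [bt mt]; split; first exact: bij_comp.
by move=> x y /=; rewrite ms mt.
Qed.

Lemma automorphism_id (M : graph) : automorphism (@id M).
Proof. by split=> //; exists id. Qed.

Lemma walk_aut (M : graph) (s : M -> M) (F : set M) l x y : automorphism s ->
  (forall z, F (s z) <-> F z) -> walk F l (s x) (s y) <-> walk F l x y.
Proof.
move=> as_ hF; have [[bs ms] injs] := (as_, bij_inj as_.1).
elim: l x => [|l IH] x /=; first by rewrite hF; split=> -[]; [move/injs->|move=> ->].
rewrite hF; split=> -[Fx [z [xz zy]]]; split=> //; last first.
  by exists (s z); rewrite ms; split=> //; apply/IH.
have [s' [as' sK s'K]] := automorphism_inv as_.
by exists (s' z); split; [rewrite -ms s'K | apply/IH; rewrite s'K].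
Qed.

Lemma conn_aut (M : graph) (s : M -> M) (F : set M) x y : automorphism s ->
  (forall z, F (s z) <-> F z) -> conn F (s x) (s y) <-> conn F x y.
Proof. by move=> a h; split=> -[l /(walk_aut l x y a h)]; exists l. Qed.

Definition fixes (M : graph) (A : set M) (s : M -> M) := forall x, A x -> s x = x.

Lemma fixes_mem (M : graph) (A : set M) (s : M -> M) : automorphism s -> fixes A s ->
  forall z, A (s z) <-> A z.
Proof.
move=> a fA z; split=> [Asz|Az]; last by rewrite fA.
by have /(bij_inj a.1) e := fA _ Asz; rewrite e in Asz.
Qed.

Lemma holds_fix (M : graph) n (phi : pformula M n) s (x : n.-tuple M) : automorphism s ->
  (forall z, z \in par phi -> s z = z) -> holds phi [tuple of map s x] <-> holds phi x.
Proof.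
move=> a fs; apply: (sat_automorphism _ a) => i.
rewrite -(splitK i); case: fintype.split => j /=; rewrite ?tnth_lshift ?tnth_rshift ?tnth_map //.
by rewrite fs // mem_tnth.
Qed.

Lemma tp_automorphism (M : graph) (A : set M) n (x : n.-tuple M) s :
  automorphism s -> fixes A s -> tp [tuple of map s x] A = tp x A.
Proof.
move=> a fA; apply/seteqP.
have K phi : params_in A phi -> holds phi [tuple of map s x] <-> holds phi x.
  by move=> pA; apply: (holds_fix _ a) => z /pA; exact: fA.
by split=> phi [pA /(K _ pA) h]; split.
Qed.

Lemma holds_automorphism (M : graph) n m (f : formula (n + m)) (p : m.-tuple M) (x : n.-tuple M) s :
  automorphism s ->
  holds (PFormula f [tuple of map s p]) [tuple of map s x] <-> holds (PFormula f p) x.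
Proof.
move=> a; apply: (sat_automorphism _ a) => i.
by rewrite -(splitK i); case: fintype.split => j /=; rewrite ?tnth_lshift ?tnth_rshift ?tnth_map.
Qed.

(** Hilbert's hotel: along an injective sequence [f] in [A], a new point [x] goes to [f 0] and every
    [f n] to [f n.+1]. *)
Lemma card_le_setU1 T (A : set T) x : infinite_set A -> [set x] `|` A #<= A.
Proof.
elim/Ppointed: T => T in A x *; first by case: (no x).
move=> /infiniteP/pcard_leP/unsquash f.
have fA n : A (f n) by apply: (@funS _ _ _ _ f).
have finj m n : f m = f n -> m = n by apply: (@inj _ _ _ f); rewrite inE.
pose g y := if `[< y = x >] then f 0 else
  if pselect (exists n, y = f n) is left e then f (projT1 (cid e)).+1 else y.
have [Ax|nAx] := EM (A x).
  by rewrite (_ : _ `|` _ = A) ?card_lexx //; apply/setUidPr => ? ->.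
have gP y : A y -> (exists n, y = f n /\ g y = f n.+1) \/ (g y = y /\ forall n, y <> f n).
  move=> Ay; rewrite /g; case: asboolP => [yx|_]; first by case: nAx; rewrite -yx.
  case: pselect => [e|e]; first by left; case: cid => n /= ->; exists n.
  by right; split=> // n yn; apply: e; exists n.
have gx : g x = f 0 by rewrite /g; case: asboolP.
have hg : $|{injfun [set x] `|` A >-> A}|.
  apply/injfunPex; exists g.
    by move=> y [->|/[dup] Ay /gP[[n [_ ->]]|[-> _]]] //; rewrite gx.
  have gAx y : A y -> g y <> f 0.
    by move=> /gP[[n [_ ->]] /finj|[-> h] /h].
  move=> y z; rewrite !inE => -[->|Ay] [->|Az] //; rewrite ?gx.
  - by move=> /esym /(gAx _ Az).
  - by move=> /(gAx _ Ay).
  case: (gP _ Ay) => [[n [-> ->]]|[-> hy]]; case: (gP _ Az) => [[m [-> ->]]|[-> hz]] //.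
  - by move/finj => [->].
  - by move=> h; case: (hz n.+1).
  - by move=> h; case: (hy m.+1).
by case: hg => h; exact: inj_card_le h.
Qed.

(** Points are added one at a time: an infinite set absorbs the new point, and a finite set stays
    finite, hence below the uncountable [kappa]. *)
Lemma small_setU (M : graph) kappa (A F : set M) : ~ countable [set: kappa] ->
  small kappa A -> finite_set F -> small kappa (F `|` A).
Proof.
move=> unc sA /finite_seqP[s ->]; elim: s => [|x s IH].
  by rewrite (_ : _ `|` _ = A) //; apply/setUidPr => y.
have -> : [set` x :: s] `|` A = [set x] `|` ([set` s] `|` A).
  rewrite setUA; congr (_ `|` _); apply/seteqP; split=> y /=; rewrite inE.
    by case/predU1P; [left | right].
  by case=> [->|->]; rewrite ?eqxx ?orbT.
move: {A sA}(_ `|` A) IH => A [Ak nkA].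
have [fA|iA] := EM (finite_set A).
  have fx : finite_set ([set x] `|` A) by rewrite finite_setU.
  split; last by move=> h; apply: unc; apply: card_le_trans h (finite_set_countable fx).
  apply: card_le_trans (finite_set_countable fx) _; apply/infiniteP => h.
  exact/unc/finite_set_countable.
have h := card_le_setU1 x iA; split; first exact: card_le_trans h Ak.
by move=> h'; apply: nkA; apply: card_le_trans h' h.
Qed.

Lemma tp_sat (M : graph) (A : set M) m k (x y : m.-tuple M) (phi : formula (m + k)) (w : k.-tuple M) :
  tp x A = tp y A -> [set` w] `<=` A -> sat phi [tuple of x ++ w] <-> sat phi [tuple of y ++ w].
Proof.
move=> e wA; have K z : tp z A (PFormula phi w) <-> sat phi [tuple of z ++ w].
  by split=> [[]|].
by rewrite -!K e.
Qed.

Lemma homogeneous_tuple (M : graph) kappa (A : set M) m (x y : m.-tuple M) :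
  strongly_homogeneous M kappa -> small kappa ([set` x] `|` A) -> tp x A = tp y A ->
  exists s, [/\ automorphism s, fixes A s & [tuple of map s x] = y].
Proof.
move=> hom sm exy.
have eqx i j : tnth x i = tnth x j -> tnth y i = tnth y j.
  have w0 : [set` [tuple] : 0.-tuple M] `<=` A by move=> z.
  have := tp_sat (FEq (lshift 0 i) (lshift 0 j)) exy w0.
  by rewrite /= !tnth_lshift => -[].
have eqA i a : A a -> tnth x i = a -> tnth y i = a.
  move=> Aa; have w1 : [set` [tuple a] : 1.-tuple M] `<=` A.
    by move=> z /=; rewrite inE => /eqP ->.
  have := tp_sat (FEq (lshift 1 i) (rshift m ord0)) exy w1.
  by rewrite /= !tnth_lshift !tnth_rshift => -[].
(* Outside [x] the index is the length of [x], so the default makes [f] the identity there. *)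
pose f z := nth z y (index z x).
have fx i : f (tnth x i) = tnth y i.
  have h : index (tnth x i) x < m by have := index_mem (tnth x i) x; rewrite mem_tnth size_tuple.
  have e : tnth x (Ordinal h) = tnth x i.
    by rewrite (tnth_nth (tnth x i) x (Ordinal h)) /= nth_index // mem_tnth.
  by rewrite -(eqx _ _ e) (tnth_nth (tnth x i) y).
have fA a : A a -> f a = a.
  move=> Aa; have [/tnthP[i ai]|nax] := boolP (a \in x).
    by rewrite {1}ai fx; apply: eqA.
  by rewrite /f nth_default // size_tuple -{1}(size_tuple x) memNindex.
have [|s [as_ sf]] := hom _ f sm.
  move=> n phi v vS.
  (* Entries of [v] outside [x] lie in [A], so they can serve as parameters when the types are
     compared. *)
  pose w := [seq z <- v | z \notin x].
  have wA : [set` in_tuple w] `<=` A.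
    by move=> z /=; rewrite mem_filter => /andP[zx /vS[/=|//]]; rewrite (negbTE zx).
  have gP i : {j | tnth v i = tnth [tuple of x ++ in_tuple w] j &
                   f (tnth v i) = tnth [tuple of y ++ in_tuple w] j}.
    apply: cid2; have [/tnthP[k e]|nx] := boolP (tnth v i \in x).
      by exists (lshift _ k); rewrite !tnth_lshift // e fx.
    have /tnthP[k e] : tnth v i \in in_tuple w by rewrite mem_filter nx mem_tnth.
    by exists (rshift _ k); rewrite !tnth_rshift // e fA //; apply: wA; apply: mem_tnth.
  have [g g1 g2] := all_sig2 gP.
  rewrite -(sat_rename phi g1) (tp_sat _ exy wA); apply: sat_rename => i.
  by rewrite tnth_map g2.
by exists s; split=> //; [move=> a Aa; rewrite sf ?fA //; right
  | apply: eq_from_tnth => i; rewrite tnth_map sf ?fx //; left; apply: mem_tnth].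
Qed.

(** Directedness replaces conjunction: finitely many formulas, each holding on a member of [B], all
    hold on one member, which is nonempty. *)
Lemma saturation_base (M : graph) kappa (A : set M) (B : set (set M)) :
  saturated M kappa -> small kappa A -> B !=set0 ->
  (forall S, B S -> dfn A (fun e => S (e 0)) /\ S !=set0) ->
  (forall S T, B S -> B T -> exists2 U, B U & U `<=` S `&` T) ->
  exists x, forall S, B S -> S x.
Proof.
move=> sat_ sm [S0 BS0] Bdef Bdir.
pose p : set (pformula M 1) :=
  [set phi | params_in A phi /\ exists2 S, B S & forall x, S x -> holds phi [tuple x]].
have [] := sat_ A p sm.
- by move=> phi [].
- move=> F /(@finite_seqP {classic (pformula M 1)})[s ->] sp.
  have [S BS HS] : exists2 S, B S & forall phi, phi \in s -> forall x, S x -> holds phi [tuple x].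
    elim: s sp => [|phi s IH] sp; first by exists S0.
    have [phi' ps|S BS HS] := IH; first by apply: sp; rewrite /= inE ps orbT.
    have [_ [T BT HT]] := sp phi (mem_head _ _).
    have [U BU UST] := Bdir _ _ BS BT; exists U => // psi.
    rewrite inE => /predU1P[->|ps] x /UST[Sx Tx]; first exact: HT.
    exact: HS.
  have [_ [x Sx]] := Bdef _ BS.
  by exists x => phi /= /HS; apply.
move=> x Hx; exists x => S BS.
have [/(dfn_pformula (ord0 : 'I_1))[phi [pA hphi]] _] := Bdef _ BS.
have : holds phi [tuple x] by apply: Hx; split=> //; exists S => // y Sy; rewrite hphi.
by rewrite hphi.
Qed.

(** This is how [acl A = A] gets used: a vertex is forced into [A] by a finite set containing it
    that is definable over [A]. *)
Lemma acl_finite (M : graph) (A S : set M) : acl A = A ->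
  dfn A (fun e => S (e 0)) -> finite_set S -> S `<=` A.
Proof.
move=> aclA /(dfn_pformula (ord0 : 'I_1))[phi [pA hphi]] fS x Sx; rewrite -aclA.
exists phi; split=> //; first by rewrite hphi.
by apply: sub_finite_set fS => y /=; rewrite hphi.
Qed.

(** Negated to match the clause [~ F x] of [walk], and asked for all terms so that it applies under
    quantifiers. *)
Definition dset (M : graph) (A F : set M) := forall f, trm A f -> dfn A (fun e => ~ F (f e)).

Lemma dset0 (M : graph) (A : set M) : dset A set0.
Proof. by move=> f _; apply/dfn_not/dfn_false. Qed.

Lemma dset1 (M : graph) (A : set M) a : A a -> dset A [set a].
Proof. by move=> Aa f tf; apply/dfn_not; apply: dfn_eq => //; exact: trm_par. Qed.

(** * Gates and bounded walks *)

(** If the walk meets [A], then [a] is its first vertex there and [v] the vertex just before. *)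
Lemma walk_first_hit (M : graph) (A F : set M) l c y : walk F l c y -> ~ A c ->
  conn A c y \/ exists v a, [/\ conn A c v, adj v a, A a & ~ F a].
Proof.
elim: l c => [|l IH] c /=; first by case=> -> _ Ac; left; apply: conn_refl.
case=> _ [z [cz zy]] Ac; have [Az|Az] := EM (A z).
  by right; exists c, z; split=> //; [exact: conn_refl | exact: walk_start zy].
have cz' : conn A c z by apply: conn1.
case: (IH _ zy Az) => [zy'|[v [a [zv va Aa Fa]]]]; first by left; apply: conn_trans zy'.
by right; exists v, a; split=> //; apply: conn_trans zv.
Qed.

(* [A] is convex, so the component of [c] outside [A] has at most one neighbour
   in [A]; removing this gate alone already cuts out the component. *)
Lemma gate (M : graph) (A : set M) c : forest M -> acl A = A -> ~ A c ->
  exists F, [/\ F `<=` A, forall A', A `<=` A' -> dset A' F, forall y, conn F c y -> conn A c y &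
    F = set0 \/ exists a v, [/\ F = [set a], adj a v & conn A c v]].
Proof.
move=> hF aclA Ac.
have [[a0 [Aa0 [l ca0]]]|nA] := EM (exists a, A a /\ conn set0 c a); last first.
  exists set0; split=> //; [by move=> A' _; exact: dset0| |by left].
  move=> y [l /walk_first_hit /(_ Ac)[//|[v [a [cv va Aa _]]]]].
  case: nA; exists a; split=> //; apply: conn_trans (conn0_sub cv) _; exact: conn1.
have [ca0'|[v [a [cv va Aa _]]]] := walk_first_hit ca0 Ac; first by case: (conn_end ca0').
have aA : [set a] `<=` A by move=> _ ->.
exists [set a]; split=> //; [by move=> A' /(_ _ Aa) /dset1 | | by right; exists a, v; rewrite adj_sym].
move=> y [k /walk_first_hit /(_ Ac)[//|[w [a' [cw wa' Aa' aa']]]]].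
have va' : conn [set a] v a'.
  apply: (@conn_trans _ _ _ w).
    exact: conn_sub (conn_trans (conn_sym cv) cw).
  by apply: conn1 => // wa; apply: (conn_end cw); rewrite wa.
case: va' => m vma'; case: (conn_end cv).
(* With a second exit [a'], the neighbours of [a] that reach [a'] by a walk of length [m] avoiding
   [a] would form a definable set with [v] as its only element, so [v] would lie in [A]. *)
apply: (@acl_finite _ _ [set u | adj a u /\ walk [set a] m u a'] aclA).
- apply: dfn_and; first by apply: dfn_adj; [exact: trm_par | exact: trm_var].
  by apply: dfn_walk (dset1 Aa) _ _; [exact: trm_var | exact: trm_par].
- apply: sub_finite_set (finite_set1 v) => u /= [au ua'].
  apply: (branch_unique hF au); first by rewrite adj_sym.
  by apply: conn_trans (conn_sym _); [exists m; exact: ua' | exists m].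
- by rewrite /= adj_sym.
Qed.

(** Bounded-length approximations to [conn], definable when [F] is; strictness makes the case
    [r = 0] empty. *)
Definition wlt (M : graph) (F : set M) r (x y : M) := exists2 l, l < r & walk F l x y.

Lemma wlt_conn (M : graph) F r (x y : M) : wlt F r x y -> conn F x y.
Proof. by case=> l _; exists l. Qed.

Lemma wlt_leq (M : graph) F r r' (x y : M) : r <= r' -> wlt F r x y -> wlt F r' x y.
Proof. by move=> rr' [l lr h]; exists l => //; apply: leq_trans rr'. Qed.

Lemma wlt_sym (M : graph) F r (x y : M) : wlt F r x y -> wlt F r y x.
Proof. by case=> l lr /walk_sym; exists l. Qed.

Lemma wlt_trans (M : graph) F r s (x y z : M) : wlt F r x y -> wlt F s y z -> wlt F (r + s) x z.
Proof.
move=> [l lr h] [k ks h']; exists (l + k)%N; last exact: walk_trans h'.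
by apply: leq_trans (leq_add lr (ltnW ks)); rewrite addSn.
Qed.

Lemma dfn_wlt (M : graph) (A F : set M) r f g : dset A F -> trm A f -> trm A g ->
  dfn A (fun e => wlt F r (f e) (g e)).
Proof.
move=> dF tf tg; elim: r => [|r IH].
  by apply: dfn_ext (dfn_false A) => e; split=> // -[].
apply: dfn_ext (dfn_or IH (dfn_walk r dF tf tg)) => e; split.
  by case=> [[l lr h]|h]; [exists l => //; apply: ltnW | exists r].
case=> l; rewrite ltnS leq_eqVlt => /predU1P[->|lr] h; first by right.
by left; exists l.
Qed.

Lemma seq_bound T (s : seq T) (P : T -> nat -> Prop) :
  (forall x n m, n <= m -> P x n -> P x m) -> (forall x, exists n, P x n) ->
  exists n, forall x, List.In x s -> P x n.
Proof.
move=> mono ex; elim: s => [|x s [n Hn]]; first by exists 0.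
have [m Hm] := ex x; exists (maxn n m) => y [<-|/Hn].
  by apply: mono Hm; rewrite leq_maxr.
by apply: mono; rewrite leq_maxl.
Qed.

Lemma fset_bound (T : choiceType) (D : {fset T}) (P : T -> nat -> Prop) :
  (forall x n m, n <= m -> P x n -> P x m) -> (forall x, exists n, P x n) ->
  exists n, forall x, x \in D -> P x n.
Proof.
move=> mono ex; have [n Hn] := seq_bound (enum_fset D) mono ex; exists n => x.
rewrite -[x \in D]/(x \in enum_fset D) => xD; apply: Hn.
by elim: (enum_fset D) xD => // y s IH; rewrite inE => /predU1P[->|/IH]; [left | right].
Qed.

(** A forest has no triangle, so a clique has at most two vertices. *)
Lemma finite_clique (M : graph) (K : set M) : forest M ->
  (forall x y, K x -> K y -> x <> y -> adj x y) -> finite_set K.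
Proof.
move=> hF hK; have [->//|/set0P[x Kx]] := eqVneq K set0.
have [[y [Ky yx]]|ny] := EM (exists y, K y /\ y <> x).
  apply: sub_finite_set (finite_set2 x y) => z Kz /=; apply: contrapT => /not_orP[zx zy].
  by apply: (@forest_triangle _ z x y) => //; apply: hK => // e; exact/yx/esym.
apply: sub_finite_set (finite_set1 x) => z Kz /=; apply: contrapT => zx.
by apply: ny; exists z.
Qed.

Lemma finite_cover (T U : choiceType) (S : set T) (D : {fset U}) (R : T -> U -> Prop) :
  (forall x, S x -> exists2 e, e \in D & R x e) ->
  (forall e, finite_set [set x | S x /\ R x e]) -> finite_set S.
Proof.
move=> cov fin; apply: (@sub_finite_set _ _ (\bigcup_(e in [set` D]) [set x | S x /\ R x e])).
  by move=> x Sx; have [e eD Rxe] := cov _ Sx; exists e.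
by apply: bigcup_finite => // e _; apply: fin.
Qed.

(** Since [z] differs from [w], a walk through [w] reaches [w] in fewer than [l] steps. *)
Lemma walk_through (M : graph) l (y z w : M) : walk set0 l y z -> z <> w ->
  conn [set w] y z \/ wlt set0 l y w.
Proof.
elim: l y => [|l IH] y /=; first by case=> -> _ zw; left; exact: conn_refl.
case=> _ [u [yu uz]] zw; have [->|yw] := EM (y = w); first by right; exists 0; rewrite //=; split=> // -[].
case: (IH _ uz zw) => [uz'|[k kl uw]].
  left; apply: conn_trans (uz'); apply: conn1 => //; exact: (conn_start uz').
by right; exists k.+1 => //; split=> //; exists u.
Qed.

(** * Moving vertices away from finite sets *)

Section FarSet.
Variables (M : graph) (A : set M) (c : M) (S : set M) (D : {fset M}) (L : nat).
Hypotheses (hF : forest M) (aclA : acl A = A) (Ac : ~ A c).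
Hypotheses (dS : dfn A (fun e => S (e 0))) (Sc : S c).

(* Only finitely many neighbours of [a] can lie in the branches at [a] that meet
   [D], while the branch of [c] starts at a neighbour that is not algebraic. *)
Lemma far_branch a v : A a -> adj a v -> conn A c v ->
  exists2 x, S x & forall e, e \in D -> ~ wlt [set a] L x e.
Proof using hF aclA Ac dS Sc.
move=> Aa av cv; apply: contrapT => H.
have near x : S x -> exists2 e, e \in D & conn [set a] x e.
  move=> Sx; apply: contrapT => H'; apply: H; exists x => // e eD /wlt_conn xe.
  by apply: H'; exists e.
(* The length [m] is fixed so that the neighbours of [a] reached from [S] by walks of length [m]
   form a definable set; it contains [v], and each point of [D] accounts for at most one of its
   elements. *)
have [m cvm] : conn [set a] c v by apply: conn_sub cv => _ ->.
apply: (conn_end cv).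
apply: (@acl_finite _ _ [set y | exists x, S x /\ (walk [set a] m x y /\ adj a y)] aclA).
- apply: (@dfn_ex _ _ (fun x e => S x /\ (walk [set a] m x (e 0) /\ adj a (e 0)))).
  apply: dfn_and => //; apply: dfn_and.
    by apply: dfn_walk (dset1 Aa) _ _; exact: trm_var.
  by apply: dfn_adj; [exact: trm_par | exact: trm_var].
- apply: (@finite_cover _ _ _ D (fun y e => conn [set a] y e)).
    move=> y [x [Sx [xy ay]]]; have [e eD xe] := near _ Sx; exists e => //.
    by apply: conn_trans xe; exists m; apply: walk_sym.
  move=> e; apply: finite_clique => // y z [[_ [_ [_ ay]]] ye] [[_ [_ [_ az]]] ze] yz.
  by case: yz; apply: (branch_unique hF ay az); apply: conn_trans (conn_sym ze).
- by exists c.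
Qed.

(* If [S] stayed near [D], then the centres of the parts of [S] in the various
   connected components would form a finite set definable over [A]. *)
Lemma far_component : (forall y, conn set0 c y -> conn A c y) ->
  exists2 x, S x & forall e, e \in D -> ~ wlt set0 L x e.
Proof using hF aclA Ac dS Sc.
move=> noA; apply: contrapT => H.
have n0 (x : M) : ~ set0 x by [].
have near x : S x -> exists2 e, e \in D & wlt set0 L x e.
  move=> Sx; apply: contrapT => H'; apply: H; exists x => // e eD xe.
  by apply: H'; exists e.
(* [N0] bounds the distances between points of [D] in a common component, so two points of [S] in a
   common component are at distance less than [N]. *)
have [N0 HN0] : exists n, forall e, e \in D -> forall e', e' \in D ->
    conn set0 e e' -> wlt set0 n e e'.
  apply: fset_bound => [x n m nm h e' /h{}h /h|x]; first exact: wlt_leq.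
  apply: fset_bound => [y n m nm h /h|y]; first exact: wlt_leq.
  by have [[l xy]|] := EM (conn set0 x y); [exists l.+1; exists l | exists 0].
pose N := (L + (N0 + L))%N.
have HN x y : S x -> S y -> conn set0 x y -> wlt set0 N x y.
  move=> /near[e eD xe] /near[e' e'D ye'] xy.
  apply: (wlt_trans xe); apply: wlt_trans (wlt_sym ye'); apply: HN0 => //.
  apply: conn_trans (conn_sym (wlt_conn xe)) _.
  exact: conn_trans xy (wlt_conn ye').
(* [Z r z] makes [z] a centre of radius less than [r] for the part of [S] in its component. By [HN]
   no point of [S] there escapes the bound [N + r], which keeps the condition definable. *)
pose Z r z := (exists x, S x /\ wlt set0 r x z) /\
  forall y, S y -> wlt set0 (N + r) y z -> wlt set0 r y z.
have Zconn r z y : Z r z -> S y -> conn set0 y z -> wlt set0 r y z.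
  move=> [[x [Sx xz]] h] Sy yz; apply: h => //; apply: (@wlt_trans _ _ _ _ _ x) => //.
  by apply: HN => //; apply: conn_trans yz (conn_sym (wlt_conn xz)).
have dZ r f : trm A f -> dfn A (fun e => Z r (f e)).
  move=> tf; apply: dfn_and.
    apply: (@dfn_ex _ _ (fun x e => S x /\ wlt set0 r x (f e))).
    apply: dfn_and; first by apply: dfn_ext dS.
    by apply: dfn_wlt (@dset0 _ _) (trm_var _ _) (trm_shift tf).
  apply: (@dfn_all _ _ (fun y e => S y -> wlt set0 (N + r) y (f e) -> wlt set0 r y (f e))).
  apply: dfn_imp; first by apply: dfn_ext dS.
  by apply: dfn_imp; apply: dfn_wlt (@dset0 _ _) (trm_var _ _) (trm_shift tf).
have exr : exists r, `[< exists2 z, conn set0 c z & Z r z >].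
  exists N.+1; apply/asboolP; exists c; first exact: conn_refl.
  split; first by exists c; split=> //; exists 0 => //; split.
  by move=> y Sy /wlt_conn yc; apply: (wlt_leq (leqnSn N)); apply: HN.
case: (ex_minnP exr) => r /asboolP[z0 cz0 Zz0] rmin.
(* Minimality of the radius is only tested at the neighbours of [z], which is first-order; this
   already makes the members of [T] in one component pairwise adjacent. *)
pose T := [set z | Z r z /\ forall w, adj z w -> ~ Z r.-1 w].
have r0 : 0 < r by case: Zz0 => [[x [_ [l]]]]; case: (r).
have Tz0 : T z0.
  split=> // w zw Zw; have /rmin : `[< exists2 z, conn set0 c z & Z r.-1 z >].
    apply/asboolP; exists w => //; apply: conn_trans cz0 _; exact: conn1.
  by rewrite leqNgt prednK // leqnn.
case: (conn_end (noA _ cz0)); apply: (@acl_finite _ _ T aclA) => //.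
  apply: dfn_and; first exact: dZ (trm_var _ _).
  apply: (@dfn_all _ _ (fun w e => adj (e 0) w -> ~ Z r.-1 w)).
  apply: dfn_imp; first by apply: dfn_adj; [exact: trm_var 1 | exact: trm_var 0].
  by apply/dfn_not/dZ/trm_var.
apply: (@finite_cover _ _ _ D (fun z e => conn set0 z e)).
  move=> z [[[x [Sx xz]] _] _]; have [e eD xe] := near _ Sx; exists e => //.
  exact: conn_trans (conn_sym (wlt_conn xz)) (wlt_conn xe).
(* Two nonadjacent members [z], [z'] of [T] in one component are joined by a path starting with [z],
   [w], [w2], and then [w] would be a centre for the smaller radius [r.-1]. *)
move=> e; apply: finite_clique => // z z' [[Zz Tz] ze] [[Zz' _] ze'] zz'.
have := conn_trans ze (conn_sym ze'); move/conn_upath => [p [pp lp up _]].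
case: p pp lp up => [|w [|w2 p]] /=; first by move=> _ /zz'.
  by rewrite andbT => zw <-.
move=> /and3P[zw ww2 pp] lp /and3P[]; rewrite !inE => /norP[znw /norP[znw2 _]] /norP[wnw2 wp] _.
case: (Tz w zw).
have conn_w2 : conn [set w] w2 z'.
  rewrite -lp; apply: (path_conn pp); last exact: mem_last.
  move=> u; rewrite inE => /predU1P[->|up] /= uw; first by rewrite uw eqxx in wnw2.
  by rewrite -uw up in wp.
have zw' : z <> w by apply/eqP.
have z'w : z' <> w by apply: (conn_end conn_w2).
(* A point [y] cannot reach both [z] and [z'] without [w], as these lie in different branches at
   [w]; so one of the short walks passes [w] strictly before its end. *)
have key y : S y -> conn set0 y w -> wlt set0 r.-1 y w.
  move=> Sy yw.
  have yz : conn set0 y z by apply: conn_trans yw _; apply: conn1 => //; rewrite adj_sym.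
  have yz' : conn set0 y z'.
    by apply: conn_trans yz (conn_trans ze (conn_sym ze')).
  have [l lr wl] := Zconn _ _ _ Zz Sy yz; have [l' lr' wl'] := Zconn _ _ _ Zz' Sy yz'.
  have ll : l <= r.-1 by rewrite -ltnS prednK.
  have ll' : l' <= r.-1 by rewrite -ltnS prednK.
  case: (walk_through wl zw') => [c1|]; last exact: wlt_leq.
  case: (walk_through wl' z'w) => [c2|]; last exact: wlt_leq.
  case/eqP: znw2; apply: (@branch_unique _ w) => //; first by rewrite adj_sym.
  exact: conn_trans (conn_sym c1) (conn_trans c2 (conn_sym conn_w2)).
split; last by move=> y Sy /wlt_conn; apply: key.
have [[x [Sx xz]] _] := Zz; exists x; split=> //; apply: key => //.
by apply: conn_trans (wlt_conn xz) _; apply: conn1.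
Qed.

End FarSet.

Section Moving.
Variables (kappa : Type) (M : graph) (A : set M).
Hypotheses (unc : ~ countable [set: kappa]) (sat_ : saturated M kappa)
  (hom : strongly_homogeneous M kappa) (smA : small kappa A)
  (hF : forest M) (aclA : acl A = A).

(** By the two lemmas on far points, being far from [D] is finitely consistent with the type of [c]
    over [A]; saturation realizes all of it at once and homogeneity carries [c] to the
    realization. *)
Lemma move_vertex c (D : {fset M}) : ~ A c ->
  exists s, [/\ automorphism s, fixes A s & forall e, e \in D -> ~ conn A (s c) e].
Proof using unc sat_ hom smA hF aclA.
move=> Ac; have [F [FA dF FconnA Fcase]] := gate hF aclA Ac.
(* Distances are measured around the gate [F] instead of [A], since [F] is definable over [A]. *)
pose B : set (set M) := [set U | exists S L, [/\ dfn A (fun e => S (e 0)), S c &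
  U = S `&` [set x | forall e, e \in D -> ~ wlt F L x e]]].
have [] := @saturation_base M kappa ([set` D] `|` A) B sat_ _ _ _ _.
- by apply: small_setU => //; exact: finite_fset.
- exists (setT `&` [set x | forall e, e \in D -> ~ wlt F 0 x e]); exists setT, 0; split=> //.
  exact: dfn_true.
- move=> U [S [L [dS Sc ->]]]; split.
    apply: dfn_and; first by apply: dfn_sub dS => x; right.
    have dF' : dset ([set` D] `|` A) F by apply: dF => z; right.
    have : [set` enum_fset D] `<=` [set` D] by [].
    suff : forall s : seq M, [set` s] `<=` [set` D] ->
        dfn ([set` D] `|` A) (fun e => forall d, d \in s -> ~ wlt F L (e 0) d).
      by move=> /(_ (enum_fset D)).
    elim=> [|d s IH] sD.
      by apply: dfn_ext (dfn_true _) => e; split.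
    apply: dfn_ext (dfn_and (dfn_not (dfn_wlt L dF' (trm_var _ 0)
      (@trm_par _ _ d _))) (IH _)); last first.
    - by move=> x xs; apply: sD; rewrite /= inE xs orbT.
    - by left; apply: sD; rewrite /= inE eqxx.
    move=> e; split; first by move=> [h1 h2] d'; rewrite inE => /predU1P[->|/h2].
    move=> h; split; first by apply: h; rewrite inE eqxx.
    by move=> d' ds; apply: h; rewrite inE ds orbT.
  have [x Sx xD] : exists2 x, S x & forall e, e \in D -> ~ wlt F L x e.
    case: Fcase => [F0|[a [v [Fa av cv]]]].
      by rewrite F0 in FconnA *; apply: far_component FconnA.
    by rewrite Fa in FA *; apply: (far_branch D L hF aclA Ac dS Sc _ av cv); apply: FA.
  by exists x.
- move=> _ _ [S [L [dS Sc ->]]] [S' [L' [dS' Sc' ->]]].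
  exists ((S `&` S') `&` [set x | forall e, e \in D -> ~ wlt F (maxn L L') x e]).
    by exists (S `&` S'), (maxn L L'); split=> //; apply: dfn_and.
  move=> x [[Sx S'x] h]; split; split=> // e eD xe; apply: (h e eD).
    by apply: wlt_leq xe; rewrite leq_maxl.
  by apply: wlt_leq xe; rewrite leq_maxr.
move=> x Bx.
have SBx S : dfn A (fun e => S (e 0)) -> S c -> S x.
  move=> dS Sc; have : (S `&` [set x | forall e, e \in D -> ~ wlt F 0 x e]) x.
    by apply: Bx; exists S, 0.
  by case.
have dphi (phi : pformula M 1) : params_in A phi -> dfn A (fun e => holds phi [tuple e 0]).
  move=> pA; apply: dfn_ext (dfn_holds (fun=> 0) pA) => e.
  rewrite (_ : [tuple e 0 | i < 1] = [tuple e 0]) //.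
  by apply: eq_from_tnth => i; rewrite tnth_mktuple (ord1 i).
have etp : tp [tuple c] A = tp [tuple x] A.
  apply/seteqP; split=> phi [pA hphi]; split=> //.
    exact: (SBx [set y | holds phi [tuple y]] (dphi _ pA)).
  apply: contrapT => nh.
  exact: (SBx [set y | ~ holds phi [tuple y]] (dfn_not (dphi _ pA))).
have sm1 : small kappa ([set` [tuple c]] `|` A).
  by apply: small_setU => //; apply/finite_seqP; exists [:: c].
have [s [as_ fA sx]] := homogeneous_tuple hom sm1 etp.
exists s; split=> // e eD; have -> : s c = x by case: sx.
move=> /(conn_sub FA)[l xe].
have : (setT `&` [set x | forall e, e \in D -> ~ wlt F l.+1 x e]) x.
  by apply: Bx; exists setT, l.+1; split=> //; apply: dfn_true.
by case=> _ /(_ e eD); apply; exists l.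
Qed.

End Moving.

(** * Separation and non-forking *)

(** An edge leaving [U] ends in [A], which [t] fixes pointwise, so exchanging [U] with its image
    along [t] preserves adjacency. *)
Lemma swap_branches (M : graph) (A U : set M) t : automorphism t -> fixes A t ->
  (forall x, U x -> ~ A x) -> (forall x y, U x -> adj x y -> U y \/ A y) ->
  (forall x, U x -> ~ U (t x)) ->
  exists r, [/\ automorphism r, forall x, U x -> r x = t x &
    forall x, ~ U x -> (forall y, U y -> t y <> x) -> r x = x].
Proof.
move=> at_ fA UA Ucl Ut; have [t' [_ tK t'K]] := automorphism_inv at_.
have tadj := at_.2.
pose r x := if `[< U x >] then t x else if `[< U (t' x) >] then t' x else x.
have rU x : U x -> r x = t x by move=> h; rewrite /r asboolT.
have rV x : U x -> r (t x) = x.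
  by move=> h; rewrite /r asboolF ?tK ?asboolT //; exact: Ut.
have rO x : ~ U x -> ~ U (t' x) -> r x = x by move=> h h'; rewrite /r !asboolF.
have cases x : [\/ U x, exists2 y, U y & x = t y | ~ U x /\ ~ U (t' x)].
  have [Ux|nUx] := EM (U x); first by constructor 1.
  have [Ux|nUx'] := EM (U (t' x)); last by constructor 3.
  by constructor 2; exists (t' x).
have rr : involutive r.
  move=> x; case: (cases x) => [Ux|[y Uy ->]|[h h']].
  - by rewrite (rU _ Ux) rV.
  - by rewrite (rV _ Uy) rU.
  - by rewrite !(rO _ h h').
have adjU x y : U x -> adj x y -> adj (r x) (r y).
  move=> Ux xy; rewrite (rU _ Ux).
  case: (cases y) => [Uy|[z Uz yz]|[h h']]; first by rewrite rU // tadj.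
    case: (Ucl _ _ Ux xy); first by rewrite yz => /(Ut _ Uz).
    by rewrite yz => /(fixes_mem at_ fA) /(UA _ Uz).
  case: (Ucl _ _ Ux xy) => // Ay; rewrite rO // -(fA y) // tadj //.
have adjV x y : U x -> adj (t x) y -> adj (r (t x)) (r y).
  move=> Ux xy; rewrite (rV _ Ux); case: (cases y) => [Uy|[z Uz yz]|[h h']].
  - by rewrite adj_sym -(rV _ Ux); apply: adjU => //; rewrite adj_sym.
  - by rewrite yz rV // -tadj -yz.
  have xy' : adj x (t' y) by rewrite -tadj t'K.
  case: (Ucl _ _ Ux xy') => // /fA; rewrite t'K rO // => ->; exact: xy'.
have radj x y : adj x y -> adj (r x) (r y).
  case: (cases x) => [Ux|[z Uz ->]|[h h']]; [exact: adjU | exact: adjV |].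
  case: (cases y) => [Uy|[z Uz ->]|[k k']].
  - by rewrite adj_sym [adj (r x) _]adj_sym; apply: adjU.
  - by rewrite adj_sym [adj (r x) _]adj_sym; apply: adjV.
  - by rewrite !rO.
exists r; split=> //.
  split; first by exists r.
  by move=> x y; apply/idP/idP => [/radj|/radj//]; rewrite !rr.
by move=> x h1 h2; apply: rO => // /h2; apply; rewrite t'K.
Qed.

(** Here [U] is the union of the components outside [A] of the entries of [b]; the hypotheses make
    [U], its image and [E] pairwise disjoint. *)
Lemma swap_seq (M : graph) (A E : set M) (b : seq M) t : automorphism t -> fixes A t ->
  (forall x e, x \in b -> E e -> ~ conn A x e) ->
  (forall x e, x \in b -> E e -> ~ conn A (t x) e) ->
  (forall x y, x \in b -> y \in b -> ~ conn A (t x) y) ->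
  exists r, [/\ automorphism r, fixes (A `|` E) r & {in b, r =1 t}].
Proof.
move=> at_ fA bE tbE tb.
have connt := conn_aut _ _ at_ (fixes_mem at_ fA).
pose U : set M := [set y | exists2 x, x \in b & conn A x y].
have [||| r [ar rU rO]] := @swap_branches M A U t at_ fA.
- by move=> y [x _ /conn_end].
- move=> y z [x xb xy] yz; have [Az|Az] := EM (A z); [by right | left].
  by exists x => //; apply: conn_trans (xy) _; apply: conn1 => //; exact: conn_end xy.
- move=> y [x xb xy] [x' x'b x'y]; apply: (tb x x') => //.
  by apply: conn_trans (conn_sym x'y); apply/connt.
exists r; split=> //.
  move=> e [Ae|Ee]; apply: rO.
  - by case=> x _ /conn_end.
  - by move=> y [x _ /conn_end yA] ye; apply: yA; rewrite -(fixes_mem at_ fA) ye.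
  - by case=> x xb /(bE _ _ xb Ee).
  - by move=> y [x xb xy] ye; apply: (tbE _ _ xb Ee); rewrite -ye; apply/connt.
move=> x xb; have [Ax|nAx] := EM (A x); last by apply: rU; exists x => //; exact: conn_refl.
rewrite fA //; apply: rO; first by case=> y _ /conn_end.
by move=> y [z _ /conn_end yA] ye; apply: yA; rewrite -(fixes_mem at_ fA) ye.
Qed.

Section Independence.
Variables (kappa : Type) (M : graph) (A : set M).
Hypotheses (unc : ~ countable [set: kappa]) (sat_ : saturated M kappa)
  (hom : strongly_homogeneous M kappa) (smA : small kappa A)
  (hF : forest M) (aclA : acl A = A).

(** The entries are moved one at a time. After [t] has treated the tail, [t x] is moved by an
    automorphism that only exchanges its component with the image, so entries elsewhere keep their
    place. *)
Lemma move_seq (b : seq M) (D : {fset M}) :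
  exists t, [/\ automorphism t, fixes A t & forall x e, x \in b -> e \in D -> ~ conn A (t x) e].
Proof using unc sat_ hom smA hF aclA.
elim: b => [|x b [t [at_ fA tD]]].
  by exists id; split=> //; exact: automorphism_id.
have [Atx|nAtx] := EM (A (t x)).
  exists t; split=> // y e; rewrite inE => /predU1P[->|]; last exact: tD.
  by move=> _ /conn_start.
have [s [as_ fs sD]] := move_vertex unc sat_ hom smA hF aclA (D `|` [fset t z | z in x :: b])%fset nAtx.
(* [E] is everything outside the two exchanged components. *)
pose E : set M := [set z | ~ conn A (t x) z /\ ~ conn A (s (t x)) z].
have [||| r [ar fr rt]] := @swap_seq M A E [:: t x] s as_ fs.
- by move=> y e; rewrite inE => /eqP -> [].
- by move=> y e; rewrite inE => /eqP -> [].
- move=> y z; rewrite !inE => /eqP -> /eqP ->; apply: sD.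
  by rewrite inE; apply/orP; right; apply/imfsetP; exists x; rewrite //= inE eqxx.
have rx : r (t x) = s (t x) by apply: rt; rewrite inE.
have frA : fixes A r by move=> z Az; apply: fr; left.
exists (r \o t); split; first exact: automorphism_comp.
  by move=> z Az /=; rewrite fA // frA.
have xD e : e \in D -> ~ conn A (s (t x)) e by move=> eD; apply: sD; rewrite inE eD.
move=> y e; rewrite inE => /predU1P[->|yb] eD /=; first by rewrite rx; exact: xD.
(* An entry in the component of [t x] travels with it; any other entry lies in neither component, by
   the choice of [s]. *)
have [c1|c1] := EM (conn A (t x) (t y)).
  move=> ye; apply: (xD e eD); apply: conn_trans ye; rewrite -rx.
  by apply/(conn_aut _ _ ar (fixes_mem ar frA)).
rewrite fr; first exact: tD.
right; split=> //; apply: sD; rewrite inE; apply/orP; right.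
by apply/imfsetP; exists y; rewrite //= inE yb orbT.
Qed.

(** A copy [t x], unconnected outside [A] to the [c i] and to the copies [s i x] for [i < k],
    realizes these conjugates together: for each [i] a swap fixes [c i] and carries [s i x], which
    satisfies the conjugate, to [t x]. *)
Lemma not_divides n (phi : pformula M n) (x : n.-tuple M) : holds phi x ->
  (forall y e, y \in x -> e \in par phi -> ~ conn A y e) -> ~ divides A phi.
Proof using unc sat_ hom smA hF aclA.
move=> hx sep [k [c [ctp]]].
have smp : small kappa ([set` par phi] `|` A).
  by apply: small_setU => //; apply/finite_seqP; exists (par phi).
have sP i : {s | [/\ automorphism s, fixes A s & [tuple of map s (par phi)] = c i]}.
  by apply: cid; apply: homogeneous_tuple hom smp _; rewrite ctp.
pose s i := projT1 (sP i).
pose X := [fset z in flatten [seq tval (c i) ++ map (s i) x | i <- iota 0 k]]%fset.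
have [t [at_ ft tX]] := move_seq x X.
have inX i z : i < k -> z \in tval (c i) ++ map (s i) x -> z \in X.
  move=> ik zi; rewrite inE /=; apply/flattenP; exists (tval (c i) ++ map (s i) x) => //.
  by apply/mapP; exists i => //; rewrite mem_iota add0n.
move=> /(_ [fset i in iota 0 k]%fset); case.
  by rewrite card_fseq undup_id ?iota_uniq // size_iota.
exists [tuple of map t x] => i; rewrite !inE mem_iota add0n /= => ik.
have [as_ fs sc] := projT2 (sP i); rewrite -/(s i) in as_ fs sc.
have [s' [as' sK s'K]] := automorphism_inv as_.
have fs' : fixes A s' by move=> z Az; rewrite -{1}(fs z Az) sK.
have afs : fixes A (t \o s') by move=> z Az /=; rewrite fs' // ft.
have [||| r [ar fr rt]] :=
  @swap_seq M A [set` c i] (map (s i) x) (t \o s') (automorphism_comp at_ as') afs.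
- move=> _ e /mapP[y yx ->]; rewrite -sc /= => /mapP[z zp ->].
  by rewrite (conn_aut _ _ as_ (fixes_mem as_ fs)); exact: sep.
- move=> _ e /mapP[y yx ->] /= eci; rewrite sK; apply: tX => //.
  by apply: (inX i) => //; rewrite mem_cat eci.
- move=> _ z /mapP[y yx ->] /= zx; rewrite sK; apply: tX => //.
  by apply: (inX i) => //; rewrite mem_cat zx orbT.
have -> : [tuple of map t x] = [tuple of map r [tuple of map (s i) x]].
  apply: eq_from_tnth => j; rewrite !tnth_map rt /= ?sK //.
  by apply/map_f/mem_tnth.
apply/holds_fix => //; first by move=> z zc; apply: fr; right.
by rewrite -sc; apply/holds_automorphism => //; case: (phi) hx.
Qed.

(** A copy [t b] is moved away from the parameters of all formulas in [D] while still satisfying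
    [phi]; it satisfies some [psi] in [D], which then cannot divide. *)
Lemma separated_nonforking n (b : n.-tuple M) (C : set M) :
  (forall x c, x \in b -> C c -> ~ conn A x c) -> nonforking_independent b C A.
Proof using unc sat_ hom smA hF aclA.
move=> sep phi [pA hphi] [D [fD Ddiv Dcov]].
have /finite_fsetP[E EE] : finite_set (\bigcup_(psi in D) [set` par psi]).
  by apply: bigcup_finite => // psi _; apply/finite_seqP; exists (par psi).
have [t [at_ ft tX]] := move_seq b (E `|` [fset z in tval (par phi)] `|` [fset z in tval b])%fset.
have [||| r [ar fr rt]] := @swap_seq M A [set` par phi] b t at_ ft.
- by move=> x e xb /pA[Ae /conn_end//|]; exact: sep.
- by move=> x e xb /= ep; apply: tX => //; rewrite !inE ep orbT.
- by move=> x y xb yb; apply: tX => //; rewrite !inE yb orbT.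
have hb : holds phi [tuple of map t b].
  have -> : [tuple of map t b] = [tuple of map r b].
    by apply: eq_from_tnth => j; rewrite !tnth_map rt // mem_tnth.
  by apply/holds_fix => // z zp; apply: fr; right.
have [psi Dpsi hpsi] := Dcov _ hb.
apply: (not_divides hpsi) (Ddiv _ Dpsi) => _ e /mapP[x xb ->] ep; apply: tX => //.
have : [set` E] e by rewrite -EE; exists psi.
by rewrite /= !inE => ->.
Qed.

(** If [x] and [c] were connected outside [A], the formula saying that this entry of the tuple
    reaches [c] by a walk of fixed length around the gate [F] would divide: conjugates of [c] can be
    put in different components outside [A]. *)
Lemma nonforking_separated n (b : n.-tuple M) (C : set M) : nonforking_independent b C A ->
  forall x c, x \in b -> C c -> ~ conn A x c.
Proof using unc sat_ hom smA hF aclA.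
move=> nf _ c /tnthP[i ->] Cc bc; have Ac := conn_end bc.
have [F [FA dF FconnA _]] := gate hF aclA Ac.
have [l wbc] := conn_sub FA bc.
have [phi [pA hphi]] : exists phi : pformula M n, params_in (A `|` C) phi /\
    forall x, holds phi x <-> walk F l (tnth x i) c.
  have [|phi [pA hphi]] := @dfn_pformula M (A `|` C) (fun e => walk F l (e i) c) n i.
    apply: dfn_walk (trm_var _ _) (@trm_par _ _ _ _); last by right.
    by apply: dF => z; left.
  by exists phi; split=> // x; rewrite hphi /env -tnth_nth.
apply: (nf phi); first by split=> //; apply/hphi.
exists [set phi]; split; [exact: finite_set1 | | by move=> x hx; exists phi].
move=> _ ->.
have nextP (h : seq M) : {s | [/\ automorphism s, fixes A s &
    forall e, e \in h -> ~ conn A (s c) e]}.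
  apply: cid; have [s [as_ fs sD]] :=
    move_vertex unc sat_ hom smA hF aclA [fset z in h]%fset Ac.
  by exists s; split=> // e eh; apply: sD; rewrite inE.
pose next h := projT1 (nextP h).
(* [hist k] lists the images of [c] chosen before stage [k], and [next] avoids the components of all
   of them. *)
pose hist := fix hist k := if k is k'.+1 then next (hist k') c :: hist k' else [::].
pose s k := next (hist k).
have sP k : [/\ automorphism (s k), fixes A (s k) &
    forall e, e \in hist k -> ~ conn A (s k c) e] := projT2 (nextP (hist k)).
have shist j k : j < k -> s j c \in hist k.
  elim: k => // k IH; rewrite ltnS leq_eqVlt inE => /predU1P[->|/IH ->]; last by rewrite orbT.
  by rewrite eqxx.
(* Any two of these conjugates are inconsistent, hence the 2. *)
exists 2, (fun k => [tuple of map (s k) (par phi)]); split.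
  by move=> k; have [as_ fs _] := sP k; apply: tp_automorphism.
move=> I cI [x Hx].
have connx k : k \in I -> conn F (tnth x i) (s k c).
  move=> kI; have [as_ fs _] := sP k.
  have [s' [as' sK s'K]] := automorphism_inv as_.
  have := Hx k kI; have -> : x = [tuple of map (s k) [tuple of map s' x]].
    by apply: eq_from_tnth => j; rewrite !tnth_map s'K.
  move/(holds_automorphism (pform phi) (par phi) _ as_).
  rewrite (_ : PFormula _ _ = phi); last by case: (phi).
  move/hphi; rewrite !tnth_map => w; exists l; apply/walk_aut => //.
  by apply: fixes_mem => // z /FA; exact: fs.
have [j [k [jI kI jk]]] : exists j k, [/\ j \in I, k \in I & j < k].
  have : 0 < #|` I| by rewrite cI.
  rewrite cardfs_gt0 => /fset0Pn[j jI]; move: cI; rewrite (cardfsD1 j) jI add1n => -[h].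
  have : 0 < #|` (I `\ j)%fset| by rewrite h.
  rewrite cardfs_gt0 => /fset0Pn[k]; rewrite !inE => /andP[kj kI].
  by case: (ltngtP j k) kj => // jk _; [exists j, k | exists k, j].
have [as_ fs sep] := sP k; apply: (sep (s j c)); first exact: shist.
have [s' [as' sK s'K]] := automorphism_inv as_.
have FF : fixes F (s k) by move=> z /FA; exact: fs.
(* [FconnA] speaks of [c] alone, so the connection is pulled back along [s k]. *)
rewrite -[s j c]s'K; apply/(conn_aut _ _ as_ (fixes_mem as_ fs)); apply: FconnA.
apply/(conn_aut _ _ as_ (fixes_mem as_ FF)); rewrite s'K.
exact: conn_trans (conn_sym (connx _ kI)) (connx _ jI).
Qed.

End Independence.

(** * Models of the theory are forests *)

Fixpoint all_close n : formula n -> formula 0 :=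
  match n return formula n -> formula 0 with
  | 0 => id
  | n'.+1 => fun phi => all_close (FAll phi)
  end.

Lemma sat_all_close (M : graph) n (phi : formula n) :
  sat (all_close phi) ([tuple] : 0.-tuple M) <-> forall v : n.-tuple M, sat phi v.
Proof.
elim: n phi => [|n IH] phi /=.
  by split=> [h v|]; [rewrite (tuple0 v) | apply].
rewrite IH; split=> [h v|h v a]; last exact: h.
by have := h [tuple of behead v] (thead v); rewrite -tuple_eta.
Qed.

Definition literal n (b : bool) (phi : formula n) := if b then phi else FImp phi (FFalse n).

Definition not_all T n (f : T -> formula n) (s : seq T) : formula n :=
  foldr (fun i psi => FImp (f i) psi) (FFalse n) s.

Lemma sat_not_all (M : graph) (T : eqType) n (f : T -> formula n) s (v : n.-tuple M) :
  sat (not_all f s) v <-> ~ forall i, i \in s -> sat (f i) v.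
Proof.
elim: s => [|i s IH] /=; first by split=> // h; apply: h.
rewrite IH; split=> [h h'|h fi h'].
  by apply: h => [|j js]; apply: h'; rewrite inE ?eqxx ?js ?orbT.
by apply: h => j; rewrite inE => /predU1P[->|/h'].
Qed.

Lemma sat_literal (M : graph) n (b : bool) (phi : formula n) (v : n.-tuple M) :
  sat (literal b phi) v -> sat phi v <-> b.
Proof. by case: b => /= h; split. Qed.

Lemma literal_sat (M : graph) n (b : bool) (phi : formula n) (v : n.-tuple M) :
  (sat phi v <-> b) -> sat (literal b phi) v.
Proof. by case: b => /= -[h h']; [exact: h' | move/h]. Qed.

Lemma delta_iso (M G : graph) (h : M -> G) (s : seq M) : uniq s ->
  {in s &, injective h} -> {in s &, {mono h : x y / adj x y}} ->
  delta [fset x in map h s]%fset = delta [fset x in s]%fset.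
Proof.
elim: s => [|x s IH] /=; first by rewrite !fset_nil !delta0.
case/andP=> xs us hinj hadj; rewrite !fset_cons.
have sub y : y \in s -> y \in x :: s by rewrite inE orbC => ->.
have hxs : h x \notin map h s.
  apply/mapP => -[y ys /hinj]; rewrite mem_head sub // => /(_ isT isT) xy.
  by rewrite xy ys in xs.
have hinj' : {in s &, injective h} by move=> y z ys zs; apply: hinj; apply: sub.
have hus : uniq (map h s) by rewrite map_inj_in_uniq.
rewrite !delta_add1 ?inE // !deg_count // IH //; last first.
  by move=> y z ys zs; apply: hadj; apply: sub.
congr (_ - (_ : nat)%:Z)%R; rewrite count_map; apply: eq_in_count => y ys /=.
by rewrite hadj ?mem_head ?sub.
Qed.

(** A finite subset of [M] is described up to isomorphism by its equalities and adjacencies. If no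
    tuple of [G] satisfied this description, [Th G] would contain a sentence excluding it from [M];
    so [G] contains a copy, with the same delta. *)
Lemma forest_models (G M : graph) : forest G -> models M (Th G) -> forest M.
Proof.
move=> hG hM X X0.
have [s us Xs] : exists2 s : seq M, uniq s & X = [fset z in s]%fset.
  by exists (enum_fset X); rewrite ?fset_uniq //; apply/fsetP => z; rewrite inE.
pose x := in_tuple s; pose n := size s.
have [i0 _] : exists i : 'I_n, true.
  case/fset0Pn: X0 => z; rewrite Xs inE /= => zs.
  have h : index z s < n by rewrite index_mem.
  by exists (Ordinal h).
have xinj i j : tnth x i = tnth x j -> i = j.
  by move/tuple_uniqP: (us : uniq x); apply.
pose lit (k : ('I_n * 'I_n) + ('I_n * 'I_n)) : formula n :=
  match k with
  | inl (i, j) => literal (tnth x i == tnth x j) (FEq i j)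
  | inr (i, j) => literal (adj (tnth x i) (tnth x j)) (FAdj i j)
  end.
have [v vlit] : exists v : n.-tuple G, forall k, sat (lit k) v.
  apply: contrapT => /forallNP H.
  have : Th G (all_close (not_all lit (enum {: ('I_n * 'I_n + 'I_n * 'I_n)%type}))).
    apply/sat_all_close => v; apply/sat_not_all => h; apply: (H v) => k.
    by apply: h; rewrite mem_enum.
  move/hM/sat_all_close => /(_ x) /sat_not_all; apply => -[[i j]|[i j]] _ /=.
    by apply: literal_sat => /=; split=> [->|/eqP].
  exact: literal_sat.
have veq i j : tnth v i = tnth v j <-> tnth x i == tnth x j := sat_literal (vlit (inl (i, j))).
have vadj i j : adj (tnth v i) (tnth v j) <-> adj (tnth x i) (tnth x j) :=
  sat_literal (vlit (inr (i, j))).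
have hP z : {w | forall i, tnth x i = z -> w = tnth v i}.
  apply: cid; have [[i iz]|nz] := EM (exists i, tnth x i = z).
    by exists (tnth v i) => j jz; rewrite (xinj i j) // iz.
  by exists (tnth v i0) => i iz; case: nz; exists i.
pose h z := projT1 (hP z).
have hx i : h (tnth x i) = tnth v i by apply: (projT2 (hP _)).
rewrite Xs -(@delta_iso _ _ h) //.
- apply: hG; apply/fset0Pn; exists (tnth v i0); rewrite inE -hx map_f //.
  exact: (mem_tnth i0 x).
- move=> _ _ /(@tnthP _ _ x)[i ->] /(@tnthP _ _ x)[j ->]; rewrite !hx.
  by move/veq/eqP.
- move=> _ _ /(@tnthP _ _ x)[i ->] /(@tnthP _ _ x)[j ->]; rewrite !hx.
  by apply/idP/idP => /vadj.
Qed.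

(** * Separation and d-independence *)

Section Closure.
Variable M : graph.
Hypothesis hF : forest M.
Implicit Types (X Y : {fset M}) (x y z : M) (N : set M).

Lemma delta_ge1 X x : x \in X -> (1 <= delta X)%R.
Proof using hF.
move=> xX; have : X != fset0 by apply/fset0Pn; exists x.
by move/hF; rewrite -gtz0_ge1.
Qed.

Lemma cl_mono N N' : N `<=` N' -> cl N `<=` cl N'.
Proof. by move=> NN z [B [E [BN BE zE]]]; exists B, E; split=> //; apply: subset_trans NN. Qed.

(** The path is a weak intrinsic extension of its two ends: a subset [C] that contains the ends and
    misses [m] splits at [m] into two pieces with no edge between them, so its delta is at least 2,
    while the path has delta at most 1. *)
Lemma cl_path N x p z : path adj x p -> uniq (x :: p) -> N x -> N (last x p) ->
  z \in x :: p -> cl N z.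
Proof using hF.
move=> pp up Nx Ny zp; exists [fset x; last x p]%fset, [fset u in x :: p]%fset; split.
- by move=> u /=; rewrite !inE => /orP[] /eqP ->.
- split.
    apply/fsubsetP => u; rewrite !inE => /orP[] /eqP ->; first by rewrite eqxx.
    by rewrite -in_cons mem_last.
  move=> C /fsubsetP AC; rewrite fproperE => /andP[/fsubsetP CE /fsubsetPn[m mE mC]] [_ wc].
  have xC : x \in C by apply: AC; rewrite !inE eqxx.
  have yC : last x p \in C by apply: AC; rewrite !inE eqxx orbT.
  have neqm u : u \in C -> ~ [set m] u by move=> uC um; rewrite -um uC in mC.
  have dE := delta_path pp up.
  have : (delta C <= delta [fset u in x :: p]%fset)%R.
    by apply: wc => //; apply/fsubsetP.
  pose C1 := [fset u in C | `[< conn [set m] x u >]]%fset.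
  have C1P u : u \in C1 = (u \in C) && `[< conn [set m] x u >] by rewrite !inE.
  have xC1 : x \in C1.
    by rewrite C1P xC /=; apply/asboolP/conn_refl; exact: neqm.
  (* Otherwise the two neighbours of [m] on the path would be connected around [m]. *)
  have nyx : ~ conn [set m] x (last x p).
    have {mE} mp : m \in p.
      by move: mE; rewrite !inE => /predU1P[mx|//]; rewrite mx xC in mC.
    case/splitPr: mp pp up yC {C1 C1P xC1 wc dE zp Ny AC CE} => p1 p2.
    rewrite cat_path last_cat /= => /and3P[pp1 um pp2].
    case: p2 pp2 => [_ _|w p2 /= /andP[mw pp2]]; first by rewrite (negbTE mC).
    rewrite -[_ && _]/(uniq ((x :: p1) ++ m :: w :: p2)) cat_uniq.
    move=> /and3P[u1 /hasPn dis /= /andP[mwp2 _]] yC xy.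
    have uw : last x p1 = w.
      apply: (branch_unique hF (a := m)) => //; first by rewrite adj_sym.
      apply: (@conn_trans _ _ _ x).
        apply/conn_sym/(path_conn pp1); last exact: mem_last.
        by move=> u up1 um'; have := dis m; rewrite -um' up1 inE eqxx => /(_ isT).
      apply: conn_trans xy (conn_sym _); apply: (path_conn pp2); last exact: mem_last.
      by move=> u up2 um'; rewrite -um' up2 in mwp2.
    have /dis : last x p1 \in m :: w :: p2 by rewrite uw !inE eqxx orbT.
    by rewrite mem_last.
  pose C2 := (C `\` C1)%fset.
  have CU : (C1 `|` C2)%fset = C.
    apply/fsetP => u; rewrite in_fsetU in_fsetD.
    by case: (boolP (u \in C1)) => //; rewrite C1P => /andP[->].
  have dis : [disjoint C1 & C2]%fset.
    by apply/fdisjointP => u uC1; rewrite inE uC1.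
  have dC := @delta_disjoint_union _ C1 C2 fset0 dis.
  have := dC; rewrite CU cardfs0 => {}dC.
  have : (delta C1 + delta C2 - 0 <= delta C)%R.
    apply: dC => u w.
    rewrite C1P !inE => /andP[uC /asboolP xu] /andP[+ wC] uw.
    rewrite wC /= => /asboolP; case; apply: conn_trans (xu) _.
    by apply: conn1 => //; apply: neqm.
  have := delta_ge1 xC1.
  have yC2 : last x p \in C2 by rewrite inE C1P yC /= andbT; apply/asboolP.
  by have := delta_ge1 yC2; lia.
- by move: zp; rewrite !inE.
Qed.

Lemma subset_cl N : N `<=` cl N.
Proof using hF. by move=> x Nx; apply: (@cl_path N x [::]); rewrite //= inE. Qed.

(** Deleting from [E] the component of [z] outside [A] leaves a weakly closed set: any nonempty set
    of vertices put back has delta at least 1 and is joined to the rest by at most the one gate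
    edge. *)
Lemma not_cl (A N : set M) z : acl A = A -> ~ A z -> (forall y, N y -> ~ conn A z y) ->
  ~ cl N z.
Proof using hF.
move=> aclA Az sep [B [E [BN [/fsubsetP BE wi] zE]]].
have [F [FA _ FconnA Fcase]] := gate hF aclA Az.
pose C := [fset y in E | `[< ~ conn A z y >]]%fset.
have CP y : y \in C = (y \in E) && `[< ~ conn A z y >] by rewrite !inE.
have CE : (C `<=` E)%fset by apply/fsubsetP => y; rewrite CP => /andP[].
apply: (wi C).
- apply/fsubsetP => y yB; rewrite CP BE //=; apply/asboolP; apply: sep; exact: BN.
- rewrite fproperE CE; apply/fsubsetPn.
  by exists z => //; rewrite CP zE /=; apply/asboolP => h; apply: h; exact: conn_refl.
split=> // C' /fsubsetP CC' /fsubsetP C'E.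
pose X := [fset y in C' | `[< conn A z y >]]%fset.
have XP y : y \in X = (y \in C') && `[< conn A z y >] by rewrite !inE.
have C'U : C' = (C `|` X)%fset.
  apply/fsetP => y; rewrite inE CP XP; apply/idP/orP.
    move=> yC'; rewrite C'E // yC' /=.
    by have [h|h] := EM (conn A z y); [right | left]; apply/asboolP.
  by case=> [h|/andP[]//]; apply: CC'; rewrite CP.
have [X0|/fset0Pn[x xX]] := eqVneq X fset0.
  by rewrite C'U X0 fsetU0.
have dis : [disjoint C & X]%fset.
  by apply/fdisjointP => y; rewrite CP XP => /andP[_ /asboolP h]; apply/andP => -[_ /asboolP].
have [Q [Q1 HQ]] : exists Q : {fset {fset M}}, #|` Q| <= 1 /\
    forall x y, x \in C -> y \in X -> adj x y -> [fset x; y]%fset \in Q.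
  have key u w : u \in C -> w \in X -> adj u w -> A u /\ F u /\ conn A z w.
    rewrite CP XP => /andP[_ /asboolP nu] /andP[_ /asboolP zw] uw.
    have Au : A u.
      apply: contrapT => nAu; apply: nu; apply: conn_trans (zw) _; apply: conn1 => //.
        exact: conn_end zw.
      by rewrite adj_sym.
    split=> //; split=> //; apply: contrapT => nFu.
    apply: (@conn_end _ A z u _ Au); apply: FconnA.
    apply: conn_trans (conn_sub FA zw) _; apply: conn1 => //; last by rewrite adj_sym.
    by move=> /FA; exact: conn_end zw.
  case: Fcase => [F0|[a [v [Fa av zv]]]].
    exists fset0; rewrite cardfs0; split=> // u w uC wX uw.
    by have [_ []] := key _ _ uC wX uw; rewrite F0.
  exists [fset [fset a; v]]%fset; rewrite cardfs1; split=> // u w uC wX uw.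
  have [Au [Fu zw]] := key _ _ uC wX uw.
  have ua : u = a by rewrite Fa in Fu.
  rewrite ua in uw *; have <- : v = w; last by rewrite inE.
  apply: (branch_unique hF av uw); rewrite -Fa.
  exact: conn_sub FA (conn_trans (conn_sym zv) zw).
have := delta_disjoint_union dis HQ; rewrite -C'U.
have := delta_ge1 xX; lia.
Qed.

End Closure.

(** * Dimension as the number of components met *)

Lemma infimum_min (S : set int) m : S m -> (forall k, S k -> (m <= k)%R) ->
  infimum 0%R S = m.
Proof.
move=> Sm lb; rewrite /infimum; case: ifPn => [/eqP S0|_]; first by rewrite S0 in Sm.
have inf_m : infimums S m by split=> [k /lb //|k]; apply.
by case: xgetP => [k _ inf_k|/(_ m)//]; apply: (is_subset1_infimums inf_k inf_m).
Qed.

Section Dimension.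
Variable M : graph.
Hypothesis hF : forest M.
Implicit Types (X Y B : {fset M}) (x y z : M) (N : set M).

Definition comp x : set M := conn set0 x.

Lemma connxx x : conn set0 x x.
Proof. exact: conn_refl. Qed.

Lemma comp_eq x y : comp x = comp y <-> conn set0 x y.
Proof.
split=> [e|xy]; first by have := connxx y; rewrite -[conn _ _]/(comp y) -e.
by apply/seteqP; split=> z; apply: conn_trans => //; exact: conn_sym.
Qed.

Definition comps X : {fset set M} := [fset comp x | x in X]%fset.

Lemma comps_mem X x : x \in X -> comp x \in comps X.
Proof. by move=> xX; apply/imfsetP; exists x. Qed.

Lemma card_comps X Y : (X `<=` Y)%fset -> #|` comps X| <= #|` comps Y|.
Proof.
move=> XY; apply: fsubset_leq_card; apply/fsubsetP => _ /imfsetP[x /= xX ->].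
by apply: comps_mem; apply: (fsubsetP XY).
Qed.

(** Induction on the size: the part of [X] in one component has delta at least 1, and no edge joins
    it to the remaining part. *)
Lemma comps_le_delta X : (#|` comps X|%:Z <= delta X)%R.
Proof using hF.
have [n] := ubnP #|` X|; elim: n X => // n IH X; rewrite ltnS => Xn.
have [->|/fset0Pn[x xX]] := eqVneq X fset0.
  by rewrite delta0 /comps imfset0 cardfs0.
pose C1 := [fset y in X | `[< conn set0 x y >]]%fset.
have C1P y : y \in C1 = (y \in X) && `[< conn set0 x y >] by rewrite !inE.
pose C2 := (X `\` C1)%fset.
have xC1 : x \in C1 by rewrite C1P xX; apply/asboolP/connxx.
have XU : (C1 `|` C2)%fset = X.
  apply/fsetP => u; rewrite in_fsetU in_fsetD.
  by case: (boolP (u \in C1)) => //; rewrite C1P => /andP[->].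
have dis : [disjoint C1 & C2]%fset.
  by apply/fdisjointP => u uC1; rewrite inE uC1.
have dX : (delta C1 + delta C2 - #|` (fset0 : {fset {fset M}})|%:Z <= delta X)%R.
  rewrite -XU; apply: delta_disjoint_union => // u w.
  rewrite in_fsetD !C1P => /andP[uX /asboolP xu] /andP[+ wX] uw.
  rewrite wX /= => /asboolP; case; apply: conn_trans (xu) _; exact: conn1.
have C2n : #|` C2| < n.
  apply: leq_trans Xn; apply: fproper_ltn_card; rewrite fproperE fsubsetDl.
  by apply/fsubsetPn; exists x => //; rewrite inE xC1.
have sub : (comps X `<=` comp x |` comps C2)%fset.
  apply/fsubsetP => _ /imfsetP[y /= yX ->]; rewrite inE.
  have [yC1|yC1] := boolP (y \in C1).
    move: yC1; rewrite C1P yX /= => /asboolP xy.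
    by rewrite inE; apply/orP; left; apply/eqP/comp_eq/conn_sym.
  by rewrite comps_mem ?orbT // inE yC1.
have := fsubset_leq_card sub; have := IH _ C2n; have := delta_ge1 hF xC1.
move: dX; rewrite cardfs0 cardfsU1; lia.
Qed.

Lemma delta_extend_walk l x y Y : walk set0 l y x -> y \in Y ->
  exists Y', [/\ (Y `<=` Y')%fset, x \in Y' & (delta Y' <= delta Y)%R].
Proof.
elim: l y Y => [|l IH] y Y /=; first by case=> <- _ yY; exists Y.
case=> _ [z [yz zx]] yY.
have [|Y' [YY' xY' dY']] := IH z (z |` Y)%fset zx; first by rewrite !inE eqxx.
exists Y'; split=> //; first by apply: fsubset_trans YY'; apply: fsubsetUr.
by apply: le_trans dY' _; apply: (delta_add_neighbor yY); rewrite adj_sym.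
Qed.

(** A new point in a component already met is reached by a walk at no cost, and each new component
    costs at most 1. *)
Lemma delta_le_comps X : exists2 Y, (X `<=` Y)%fset & (delta Y <= #|` comps X|%:Z)%R.
Proof.
elim/finSet_rect: X => X IH.
have [->|/fset0Pn[x xX]] := eqVneq X fset0.
  by exists fset0; rewrite // delta0.
have [|Y XY dY] := IH (X `\ x)%fset; first exact: fproperD1.
have XE : (x |` X `\ x)%fset = X by rewrite fsetD1K.
have cX : comps X = (comp x |` comps (X `\ x))%fset by rewrite -{1}XE /comps imfsetU1.
have XY' Z : (Y `<=` Z)%fset -> x \in Z -> (X `<=` Z)%fset.
  by move=> YZ xZ; rewrite -XE fsubUset fsub1set xZ; apply: fsubset_trans YZ.
case: (boolP (comp x \in comps (X `\ x)%fset)) => [xc|xc].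
  have /imfsetP[y /= yX /comp_eq/conn_sym[l yx]] := xc.
  have [Y' [YY' xY' dY']] := delta_extend_walk yx (fsubsetP XY _ yX).
  exists Y'; first exact: XY'.
  by apply: le_trans dY' _; rewrite cX cardfsU1 xc.
exists (x |` Y)%fset; first by apply: XY'; rewrite ?fsubsetUr // !inE eqxx.
by rewrite cX cardfsU1 xc; have := delta_add_le Y x; lia.
Qed.

Lemma ddimE X : ddim X = (#|` comps X|%:Z)%R.
Proof using hF.
apply: infimum_min => [|_ [Y /= XY <-]].
  have [Y XY dY] := delta_le_comps X; exists Y => //.
  apply/eqP; rewrite eq_le dY; apply: le_trans (comps_le_delta Y).
  by rewrite lez_nat; apply: card_comps.
by apply: le_trans (comps_le_delta Y); rewrite lez_nat; apply: card_comps.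
Qed.

Lemma ddim_relE X B : ddim_rel X B = (#|` (comps X `\` comps B)%fset|%:Z)%R.
Proof using hF.
rewrite /ddim_rel !ddimE /comps imfsetU -/(comps X) -/(comps B) cardfsU fsetIC.
have := cardfsID (comps B) (comps X); lia.
Qed.

Definition unmet X N := [fset q in comps X | `[< forall z, N z -> q <> comp z >]]%fset.

(** The infimum is attained: for each of the finitely many components that meet both [X] and [N],
    [B] contains a witness from [N]. *)
Lemma ddim_overE X N : ddim_over X N = (#|` unmet X N|%:Z)%R.
Proof using hF.
have unmetP q : q \in unmet X N = (q \in comps X) && `[< forall z, N z -> q <> comp z >].
  by rewrite !inE.
apply: infimum_min => [|_ [B /= BN <-]]; last first.
  rewrite ddim_relE lez_nat; apply: fsubset_leq_card; apply/fsubsetP => q.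
  rewrite unmetP inE => /andP[-> /asboolP h]; rewrite andbT; apply/imfsetP => -[z /= zB].
  by apply: h; apply: BN.
have gP q : {B : {fset M} | [set` B] `<=` N & forall z, N z -> q = comp z -> exists2 y, y \in B & q = comp y}.
  apply: cid2; have [[z [Nz qz]]|nz] := EM (exists z, N z /\ q = comp z).
    by exists [fset z]%fset => [y /=|_ _ _]; [rewrite inE => /eqP -> | exists z; rewrite ?inE].
  by exists fset0 => // z Nz qz; case: nz; exists z.
have [g gN gq] := all_sig2 gP.
have [B BE] : exists B : {fset M}, forall y, y \in B <-> exists2 q, q \in comps X & y \in g q.
  exists (\bigcup_(q <- comps X) g q)%fset => y; split.
    by case/bigfcupP => q /andP[qX _] yq; exists q.
  by case=> q qX yq; apply/bigfcupP; exists q; rewrite ?qX.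
exists B; first by move=> y /= /BE[q _]; exact: gN.
rewrite ddim_relE; congr (_%:Z)%R; congr (#|` _|); apply/fsetP => q.
rewrite unmetP inE andbC; case: (boolP (q \in comps X)) => //= qX.
apply/idP/asboolP => [/negP h z Nz qz|h].
  have [y yq qy] := gq _ _ Nz qz; apply: h; rewrite qy; apply: comps_mem.
  by apply/BE; exists q.
apply/imfsetP => -[y /= /BE[q' _ /gN Ny]]; exact: h.
Qed.

End Dimension.

(** * Equivalence of d-independence and separation *)

Section DIndependence.
Variables (M : graph) (A C : set M) (n : nat) (b : n.-tuple M).
Hypotheses (hF : forest M) (aclA : acl A = A).

(** A component meeting [b] and [C] but not [A] would connect them outside [A], so both dimensions
    count the same components. A vertex outside [A] in both closures would be connected outside [A]
    to [b] and to [C]. *)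
Lemma separated_d_independent :
  (forall x c, x \in b -> C c -> ~ conn A x c) -> d_independent b C A.
Proof using hF aclA.
move=> sep; split.
  rewrite !ddim_overE //; congr (_%:Z)%R; congr (#|` _|); apply/fsetP => q; rewrite !inE.
  case: (boolP (q \in comps _)) => //= /imfsetP[x /=]; rewrite !inE /= => xb ->.
  apply/asboolP/asboolP => h z Az; last by apply: h; left.
  case: Az => [|Cz /comp_eq [l xz]]; first exact: h.
  have nA y : A y -> ~ conn set0 x y by move=> Ay /comp_eq; exact: h.
  have nAx : ~ A x by move=> Ax; apply: (nA _ Ax); exact: connxx.
  case: (walk_first_hit xz nAx) => [|[v [a [xv va Aa _]]]]; first exact: sep.
  by apply: (nA _ Aa); apply: conn_trans (conn0_sub xv) _; exact: conn1.
apply/seteqP; split; last first.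
  by move=> z cz; split; apply: cl_mono cz => y; [right | left].
move=> z [zb zC]; have [Az|nAz] := EM (A z); first exact: (subset_cl hF).
have nearN (N : set M) : cl (N `|` A) z -> exists2 y, N y & conn A z y.
  move=> zN; apply: contrapT => H; apply: (not_cl hF aclA nAz) zN => y.
  by case=> [Ny zy|Ay /conn_end//]; apply: H; exists y.
have [x xb zx] := nearN _ zb; rewrite setUC in zC; have [c Cc zc] := nearN _ zC.
by case: (sep x c xb Cc); apply: conn_trans (conn_sym zx) zc.
Qed.

(** Let [x] and [c] be connected outside [A]. If their component in [M] misses [A], the dimension
    drops when [C] is added. Otherwise the vertex [v] next to the gate lies on paths from [x] and
    from [c] to the gate, hence in both closures but not in [cl A]. *)
Lemma d_independent_separated : d_independent b C A ->
  forall x c, x \in b -> C c -> ~ conn A x c.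
Proof using hF aclA.
move=> [dim clE] x c xb Cc xc; have Ac := conn_end xc.
have [F [FA _ FconnA [F0|[a [v [Fa av cv]]]]]] := gate hF aclA Ac.
  move: dim; rewrite !ddim_overE // => -[] card_eq.
  set X := [fset y in tval b]%fset in card_eq.
  have sub : (unmet X (A `|` C) `<=` unmet X A)%fset.
    apply/fsubsetP => q; rewrite !inE /= => /andP[-> /asboolP h]; apply/asboolP => z Az.
    by apply: h; left.
  have /eqP e : unmet X (A `|` C) == unmet X A by rewrite eqEfcard sub card_eq /=.
  have : comp x \in unmet X A.
    rewrite !inE comps_mem ?inE //=; apply/asboolP => z Az /comp_eq xz.
    have /FconnA/conn_end : conn F c z; last by apply.
    by rewrite F0; apply: conn_trans (conn_sym (conn0_sub xc)) xz.
  rewrite -e !inE => /andP[_ /asboolP /(_ c (or_intror Cc))]; apply.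
  exact/comp_eq/(conn0_sub xc).
have Aa : A a by apply: FA; rewrite Fa.
have in_cl (N : set M) y : N y -> N a -> conn A y v -> cl N v.
  move=> Ny Na /conn_upath[p [pp lp up pA]].
  apply: (@cl_path _ hF N y (rcons p a)); rewrite ?last_rcons //.
  - by rewrite rcons_path pp lp adj_sym.
  - rewrite -rcons_cons rcons_uniq up andbT; apply/negP => /pA; exact.
  - by rewrite -rcons_cons mem_rcons inE -lp mem_last orbT.
have : cl A v.
  rewrite -clE; split.
    by apply: (in_cl _ x); [left | right | exact: conn_trans xc cv].
  by apply: (in_cl _ c); [right | left | exact: cv].
by apply: (not_cl hF aclA (conn_end cv)) => y Ay /conn_end.
Qed.

End DIndependence.

Theorem theorem4p13 (alpha : omega_plus_one)
    (G : graph) (hG : generic alpha G)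
    (kappa : Type) (M : graph) (hM : monster kappa (Th G) M)
    (n : nat) (b : n.-tuple M) (A C : set M)
    (hA : small kappa A) (hC : small kappa C) (haclA : acl A = A) :
  d_independent b C A <-> nonforking_independent b C A.
Proof.
have [unc hT sat_ hom] := hM; have [_ inK _ _ _] := hG.
have hF : forest M.
  apply: forest_models hT => X X0.
  by have [pos _] := inK X; apply: pos.
split=> h.
  apply: (separated_nonforking unc sat_ hom hA hF haclA).
  exact: (d_independent_separated hF haclA h).
apply: (separated_d_independent hF haclA).
exact: (nonforking_separated unc sat_ hom hA hF haclA h).
Qed.
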